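(* Fix $\eta\in[0,1]$ and an integer $N\ge0$, and let $\bar C_{\mathrm{BEHC}}(N)$ be the capacity of the boosted BEHC$(N)$. Then $$\bar C_{\mathrm{BEHC}}(N)\ \le\ \sup I(U^{+},U;X\mid Q),$$ where the supremum is over (finite) auxiliary alphabets $\mathcal U$, functions $f:\mathcal U\times\{0,1\}\to\{0,1\}$ with $f(u^{+},0)=0$ for all $u^{+}$, and policies $P(u^{+}\mid u,q)$ ($u,u^{+}\in\mathcal U$, $q\in\mathcal Q$) for which the kernel $T(s^{+},u^{+},q^{+}\mid s,u,q)=\sum_xP(u^{+}\mid u,q)\mathbb{1}\{x=f(u^{+},s)\}\mathbb{1}\{q^{+}=g_U(q,x)\}P_U(s^{+}\mid x,s,q)$ has a unique stationary distribution $\pi(s,u,q)$, and the mutual information is computed under the joint PMF $$\pi(s,u,q)P(u^{+}\mid u,q)\mathbb{1}\{x=f(u^{+},s)\}P_U(s^{+}\mid x,s,q)\mathbb{1}\{q^{+}=g_U(q,x)\}.$$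
   Context: $\bar\eta=1-\eta$, $[a:b]=\{a,\dots,b\}$. $\mathcal Q=[0:N]$, $g_U:\mathcal Q\times\{0,1\}\to\mathcal Q$: $g_U(q,1)=0$, $g_U(q,0)=q+1$ for $q\in[0:N-1]$, $g_U(N,0)=N$. BEHC battery law: $P(S^{+}=0\mid x,s)=\bar\eta\,\mathbb{1}\{x=s\}$ for $x\le s$. Modified law: $P_U(s^{+}\mid x,s,q)=\mathbb{1}\{s^{+}=1\}$ if $q\in\{N-1,N\}$ and $x=0$, and equal to the BEHC law otherwise. Boosted BEHC$(N)$: binary inputs with $X_i\le S_{i-1}$, $S_0=0$, $Q_0=0$, $Q_i=g_U(Q_{i-1},X_i)$, $S_i\sim P_U(\cdot\mid X_i,S_{i-1},Q_{i-1})$ given the past, output $Y_i=X_i$ (a BEHC with i.i.d. Bernoulli$(\eta)$ energy arrivals in which transmitting $N$ consecutive zeros charges the battery). Codes: message $M$ uniform on $\{1,\dots,2^{nR}\}$, encoder $X_i=e_i(M,S^{i-1},Y^{i-1})$ with $X_i\le S_{i-1}$, decoder $\hat M=d(Y^n)$; $R$ achievable if average error probability $\to0$; capacity is the supremum of achievable rates. *)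

(* Defs.v *)
From HB Require Import structures.
From mathcomp Require Import all_boot all_order all_algebra.
From mathcomp Require Import all_classical all_reals all_analysis.
Set Implicit Arguments. Unset Strict Implicit. Unset Printing Implicit Defensive.
Import Order.TTheory GRing.Theory Num.Theory.
Local Open Scope ring_scope.
Local Open Scope classical_set_scope.

Section BoostedBEHC.
Variable R : realType.

Definition log2 (x : R) : R := ln x / ln 2.

Definition gU (N : nat) (q : nat) (x : bool) : nat :=
  if x then 0%N else minn q.+1 N.

Definition behc (eta : R) (sp x s : bool) : R :=
  let p0 := (1 - eta) * (x == s)%:R in
  if sp then 1 - p0 else p0.

(* modified law P_U(s^+ | x, s, q): if q in {N-1,N} and x = 0 the battery
   is charged (s^+ = 1) surely; otherwise the BEHC law. (N-1 is truncated,
   which for N = 0 gives {0} = Q.) *)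
Definition PU (N : nat) (eta : R) (sp x s : bool) (q : nat) : R :=
  if ((q == N.-1) || (q == N)) && ~~ x then (sp == true)%:R
  else behc eta sp x s.

(* A code of blocklength n with K messages.  At (0-indexed) time i the
   encoder sees the message, the past battery states S_1..S_i (a sequence
   of size i) and the past outputs Y_1..Y_i; S_0 = 0.  The input constraint
   X_{i+1} <= S_i is imposed for every history. *)
Record code (n K : nat) := Code {
  enc : nat -> 'I_K -> seq bool -> seq bool -> bool;
  dec : seq bool -> 'I_K;
  enc_ok : forall i m ss ys, enc i m ss ys ==> last false ss
}.

(* inputs X_1..X_k produced when the message is m and the battery states are ss
   (outputs Y = X are fed back) *)
Fixpoint inputs n K (c : code n K) (m : 'I_K) (ss : seq bool) (k : nat)
  : seq bool :=
  match k with
  | 0 => [::]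
  | k'.+1 => let p := inputs c m ss k' in rcons p (enc c k' m (take k' ss) p)
  end.

Definition traj_prob (N : nat) (eta : R) n K (c : code n K) (m : 'I_K)
  (ss : n.-tuple bool) : R :=
  let xs := inputs c m ss n in
  \prod_(i < n)
    PU N eta (nth false ss i) (nth false xs i) (nth false (false :: ss) i)
       (foldl (gU N) 0%N (take i xs)).

Definition err_prob (N : nat) (eta : R) n K (c : code n K) : R :=
  (K%:R)^-1 * \sum_(m : 'I_K) \sum_(ss : n.-tuple bool)
     traj_prob N eta c m ss * (dec c (inputs c m ss n) != m)%:R.

Definition nmsg (r : R) (n : nat) : nat := `|Num.ceil (2 `^ (n%:R * r))|%N.

Definition achievable (N : nat) (eta : R) (r : R) : Prop :=
  exists C : forall n, code n (nmsg r n),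
    (fun n => err_prob N eta (C n)) @ \oo --> 0.

Definition capacity (N : nat) (eta : R) : \bar R :=
  ereal_sup [set (r%:E)%E | r in [set r | achievable N eta r]].

Definition gUo (N : nat) (q : 'I_N.+1) (x : bool) : 'I_N.+1 := inord (gU N q x).

Definition policy (U : finType) (N : nat) (P : U -> 'I_N.+1 -> U -> R) : Prop :=
  (forall u q up, 0 <= P u q up) /\ (forall u q, \sum_(up : U) P u q up = 1).

Definition kernelT (U : finType) (N : nat) (eta : R) (f : U -> bool -> bool)
  (P : U -> 'I_N.+1 -> U -> R) (z zp : bool * U * 'I_N.+1) : R :=
  let: (s, u, q) := z in let: (sp, up, qp) := zp in
  \sum_(x : bool) P u q up * (x == f up s)%:R * (qp == gUo q x)%:R
                  * PU N eta sp x s q.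

Definition stationary (T : finType) (K : T -> T -> R) (pi : T -> R) : Prop :=
  [/\ forall z, 0 <= pi z, \sum_z pi z = 1 &
      forall zp, pi zp = \sum_z pi z * K z zp].

Definition unique_stationary (T : finType) (K : T -> T -> R) (pi : T -> R)
  : Prop :=
  stationary K pi /\ forall pi', stationary K pi' -> forall z, pi' z = pi z.

Definition cond_MI (A B C : finType) (p : A -> B -> C -> R) : R :=
  \sum_(a : A) \sum_(b : B) \sum_(c : C)
    (if p a b c == 0 then 0 else
     p a b c * log2 ((p a b c * \sum_(a' : A) \sum_(b' : B) p a' b' c) /
                     ((\sum_(b' : B) p a b' c) * (\sum_(a' : A) p a' b c)))).

Definition joint (U : finType) (N : nat) (eta : R) (f : U -> bool -> bool)
  (P : U -> 'I_N.+1 -> U -> R) (pi : bool * U * 'I_N.+1 -> R)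
  (s : bool) (u : U) (q : 'I_N.+1) (up : U) (x : bool) (sp : bool)
  (qp : 'I_N.+1) : R :=
  pi (s, u, q) * P u q up * (x == f up s)%:R * PU N eta sp x s q
  * (qp == gUo q x)%:R.

Definition MI_bound (U : finType) (N : nat) (eta : R) (f : U -> bool -> bool)
  (P : U -> 'I_N.+1 -> U -> R) (pi : bool * U * 'I_N.+1 -> R) : R :=
  cond_MI (fun (a : U * U) (x : bool) (q : 'I_N.+1) =>
    \sum_(s : bool) \sum_(sp : bool) \sum_(qp : 'I_N.+1)
      joint eta f P pi s a.2 q a.1 x sp qp).

Definition sup_bound (N : nat) (eta : R) : \bar R :=
  ereal_sup [set v : \bar R | exists (U : finType) (f : U -> bool -> bool)
     (P : U -> 'I_N.+1 -> U -> R) (pi : bool * U * 'I_N.+1 -> R),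
     [/\ forall up, f up false = false, policy P,
         unique_stationary (kernelT eta f P) pi &
         v = (MI_bound eta f P pi)%:E]].

End BoostedBEHC.

(* Main.v *)
Require Import Defs.
From HB Require Import structures.
From mathcomp Require Import all_boot all_order all_algebra.
From mathcomp Require Import all_classical all_reals all_analysis.
From mathcomp Require Import ring lra zify.
Import Order.TTheory GRing.Theory Num.Theory.
Local Open Scope ring_scope.
Set Implicit Arguments.
Unset Strict Implicit.

(* A code for the boosted channel only matters through the law p(y | m) of the
   outputs.  Such a law can be realised by strategies X = A && S in which A is
   drawn from the message and the past outputs alone, and also from any better
   starting point, in particular S = 1, Q = N: the probability of a charged
   battery given the outputs can only grow.  Sending N zeros leads to exactly
   this state, whatever happened before, so that the code can be repeated
   cyclically.  As Q reveals the last output when N > 0, the cyclic scheme is a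
   policy P(u+ | u, q) with finite memory, and its only stationary law is the
   average over a cycle.  Gibbs' inequality and the chain rule bound its
   I(U+, U; X | Q) from below by the divergence, per step, between p(y | m) and
   a measure that does not depend on m, which is large by Fano's argument. *)

(** * Sums, Markov chains and divergence *)

Lemma big_tuple_rcons (V : nmodType) (T : finType) (k : nat)
    (F : seq T -> V) :
  \sum_(t : k.+1.-tuple T) F t =
  \sum_(t : k.-tuple T) \sum_(x : T) F (rcons t x).
Proof.
rewrite pair_big /=.
rewrite (reindex (fun tx : k.-tuple T * T => [tuple of rcons tx.1 tx.2])) //=.
exists (fun t : k.+1.-tuple T =>
  ([tuple of belast (thead t) (behead t)], last (thead t) (behead t))).
  move=> [t x] _ /=; congr pair; last first.
    rewrite /thead (tnth_nth x) nth0 /=.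
    by case: (tval t) => [|y s] //=; rewrite last_rcons.
  apply: val_inj; rewrite /= /thead (tnth_nth x) nth0 /=.
  by case: (tval t) => [|y s] //=; rewrite belast_rcons.
move=> t _; apply: val_inj => /=.
by rewrite -lastI [in RHS](tuple_eta t).
Qed.

Lemma big_bseq (V : nmodType) (T : finType) (M : nat) (F : seq T -> V) :
  \sum_(h : M.-bseq T) F h = \sum_(k < M.+1) \sum_(t : k.-tuple T) F t.
Proof.
rewrite sig_big_dep /= (reindex (@bseq_tagged_tuple M T)) /=.
  by apply: eq_bigr => h _.
apply: onW_bij; exact: bseq_tagged_tuple_bij.
Qed.

Lemma ln_ge1Nr (R : realType) (x : R) : 0 < x -> 1 - x^-1 <= ln x.
Proof.
move=> x0; have := @le_ln1Dx R (x^-1 - 1).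
rewrite addrCA subrr addr0 lnV ?posrE // => /(_ _).
have -> : -1 < x^-1 - 1 by rewrite ltrBDl subrr invr_gt0.
by move=> /(_ isT); lra.
Qed.

(** The bound [1 - 1/t <= ln t] at [t = x / y], scaled by [x]. Summed over two measures it is Gibbs'
    inequality. *)
Lemma gibbs_term (R : realType) (x y : R) :
  0 < x -> 0 < y -> x - y <= x * ln (x / y).
Proof.
move=> x0 y0.
have -> : x - y = x * (1 - (x / y)^-1).
  by rewrite mulrBr mulr1 invf_div mulrCA mulfV ?mulr1 ?gt_eqF.
by rewrite ler_pM2l // ln_ge1Nr // divr_gt0.
Qed.

Section Markov.
Variables (R : realType) (T : finType) (K : T -> T -> R).
Hypothesis K1 : forall z, \sum_z' K z z' = 1.

(** Certain arrival: every path of positive probability of length [k] from [z] ends at [z0]. *)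
Fixpoint reach (z0 : T) (k : nat) (z : T) : Prop :=
  if k is j.+1 then forall z', K z z' != 0 -> reach z0 j z' else z = z0.

Definition kstep (g : T -> R) (z : T) : R := \sum_z' K z z' * g z'.

Lemma reach_iter z0 k z g : reach z0 k z -> iter k kstep g z = g z0.
Proof.
elim: k z => [|k IH] z /=; first by move=> ->.
move=> H; rewrite /kstep.
rewrite (eq_bigr (fun z' => K z z' * g z0)); last first.
  move=> z' _; have [->|Kz] := eqVneq (K z z') 0; first by rewrite !mul0r.
  by rewrite (IH _ (H _ Kz)).
by rewrite -mulr_suml K1 mul1r.
Qed.

Lemma stationary_iter (pi : T -> R) k g : stationary K pi ->
  \sum_z pi z * iter k kstep g z = \sum_z pi z * g z.
Proof.
move=> [_ _ st]; elim: k => //= k <-.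
set h := iter k kstep g; rewrite /kstep.
transitivity (\sum_z' \sum_z pi z * K z z' * h z').
  by rewrite exchange_big /=; apply: eq_bigr => z _; rewrite mulr_sumr;
     apply: eq_bigr => z' _; rewrite mulrA.
by apply: eq_bigr => z' _; rewrite -mulr_suml -st.
Qed.

(* Averaging over a full period removes the dependence on the starting state,
   even though the chain itself may be periodic. *)
Lemma stationary_unique (z0 : T) (C : nat) (t : T -> nat) (pi pi' : T -> R) :
  (0 < C)%N -> reach z0 C z0 -> (forall z, reach z0 (t z) z) ->
  stationary K pi -> stationary K pi' -> forall z, pi' z = pi z.
Proof.
move=> C0 rC rt st st' z1.
pose S g k z := \sum_(j < C) iter (k + j) kstep g z.
have S0 g k : S g k z0 = S g 0%N z0.
  elim: k => // k <-; rewrite /S.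
  case: C C0 rC {S} => // C _ rC.
  (* Shifting the window by one drops time k and adds time k + C; both terms agree because [z0]
     surely returns to itself after [C] steps. *)
  rewrite big_ord_recr /= [RHS]big_ord_recl /= addrC addn0; congr (_ + _).
    have -> : (k + C = C + k)%N by rewrite addnC.
    by rewrite -[RHS](reach_iter _ rC) -iterS -iterD addSn.
  by apply: eq_bigr => i _; rewrite /bump /= add1n addnS.
have St g k z : (t z <= k)%N -> S g k z = S g 0%N z0.
  move=> /subnK <-; rewrite -(S0 g (k - t z)%N) /S; apply: eq_bigr => j _.
  by rewrite addnAC addnC iterD (reach_iter _ (rt z)).
have key p g : stationary K p -> C%:R * \sum_z p z * g z = S g 0%N z0.
  (* The sum dominates every [t z], so at this time the sum over a period no longer depends on the
     state. *)
  move=> stp; pose k := (\sum_z t z)%N.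
  have: \sum_z p z * S g k z = S g 0%N z0.
    case: (stp) => _ p1 _.
    rewrite (eq_bigr (fun z => p z * S g 0%N z0)).
      by rewrite -mulr_suml p1 mul1r.
    by move=> z _; rewrite St // /k (bigD1 z) //= leq_addr.
  move=> <-; rewrite /S.
  under [RHS]eq_bigr do rewrite mulr_sumr.
  rewrite exchange_big /=.
  rewrite [RHS](eq_bigr (fun=> \sum_z p z * g z)).
    by rewrite sumr_const card_ord mulr_natl.
  by move=> j _; rewrite stationary_iter.
have ind p : \sum_z p z * (z == z1)%:R = p z1 :> R.
  rewrite (bigD1 z1) //= eqxx mulr1 big1 ?addr0 // => z /negbTE ->.
  by rewrite mulr0.
apply: (@mulfI _ C%:R); first by rewrite pnatr_eq0 -lt0n.
by rewrite -(ind pi') -(ind pi) key // key.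
Qed.

End Markov.

(** Variational lower bound: the gap is the average divergence of p(b | a, c) from the test channel
    [w a b], nonnegative by Gibbs even if [w] is only sub-stochastic. *)
Lemma cond_MI_ge (R : realType) (A B C : finType) (p : A -> B -> C -> R)
    (w : A -> B -> R) :
  (forall a b c, 0 <= p a b c) -> (forall a b, 0 <= w a b) ->
  (forall a, \sum_b w a b <= 1) ->
  (forall a b c, p a b c != 0 -> w a b != 0) ->
  \sum_a \sum_b \sum_c p a b c * (ln (w a b /
     ((\sum_a' p a' b c) / \sum_a' \sum_b' p a' b' c)) / ln 2)
    <= cond_MI p.
Proof.
move=> p0 w0 w1 pw.
have l2 : 0 < ln 2 :> R by rewrite ln_gt0 ?ltr1n.
rewrite -subr_ge0 /cond_MI -sumrB.
under eq_bigr do rewrite -sumrB.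
under eq_bigr do under eq_bigr do rewrite -sumrB.
apply: (@le_trans _ _ (\sum_a \sum_b \sum_c
  (p a b c - (\sum_b' p a b' c) * w a b) / ln 2)).
  under eq_bigr do under eq_bigr do rewrite -mulr_suml.
  under eq_bigr do rewrite -mulr_suml.
  rewrite -mulr_suml divr_ge0 ?(ltW l2) //.
  apply: sumr_ge0 => a _; rewrite exchange_big /=; apply: sumr_ge0 => c _.
  rewrite sumrB -mulr_sumr subr_ge0 ler_piMr //; exact: sumr_ge0.
apply: ler_sum => a _; apply: ler_sum => b _; apply: ler_sum => c _.
case: ifPn => [/eqP ->|pN0].
  rewrite mul0r sub0r subr0 mulNr oppr_le0 divr_ge0 ?(ltW l2) //.
  by rewrite mulr_ge0 //; apply: sumr_ge0.
have pp : 0 < p a b c by rewrite lt0r pN0 p0.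
have wp : 0 < w a b by rewrite lt0r w0 (pw _ _ _ pN0).
set pac := \sum_b' p a b' c; set pc := \sum_a' \sum_b' p a' b' c.
set pbc := \sum_a' p a' b c.
have pac0 : 0 < pac.
  by rewrite /pac (bigD1 b) //= ltr_wpDr //; apply: sumr_ge0.
have pbc0 : 0 < pbc.
  by rewrite /pbc (bigD1 a) //= ltr_wpDr //; apply: sumr_ge0.
have pc0 : 0 < pc.
  rewrite /pc (bigD1 a) //= -/pac ltr_wpDr //.
  by apply: sumr_ge0 => a' _; apply: sumr_ge0.
rewrite /log2 mulrA [_ * (ln _ / _)]mulrA -mulrBl ler_pM2r ?invr_gt0 //.
rewrite -mulrBr -ln_div ?posrE ?divr_gt0 ?mulr_gt0 //.
(* The conditional law p(b | c) cancels between the two logarithms. *)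
have -> : p a b c * pc / (pac * pbc) / (w a b / (pbc / pc)) =
    p a b c / (pac * w a b) by field; rewrite !gt_eqF.
by apply: gibbs_term => //; apply: mulr_gt0.
Qed.

(* Gibbs' inequality against the measure R(y) K^[d y = m] / 2, whose total
   mass is at most K. *)
Lemma fano (R : realType) (Y : finType) (K : nat) (d : Y -> 'I_K)
    (p : 'I_K -> Y -> R) (r : Y -> R) :
  (0 < K)%N ->
  (forall m y, 0 <= p m y) -> (forall m, \sum_y p m y = 1) ->
  (forall y, 0 <= r y) -> \sum_y r y <= 1 ->
  (forall m y, p m y != 0 -> r y != 0) ->
  (1 - K%:R^-1 * \sum_m \sum_y p m y * (d y != m)%:R) * ln K%:R - ln 2
    <= K%:R^-1 * \sum_m \sum_y p m y * ln (p m y / r y).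
Proof.
move=> K0 p0 p1 r0 r1 pr.
have KR : 0 < K%:R :> R by rewrite ltr0n.
have K_ge0 := ltW KR.
have KN0 : K%:R != 0 :> R by rewrite gt_eqF.
have term m y : p m y * ((d y == m)%:R * ln K%:R - ln 2) + p m y
   - r y * ((1 + (d y == m)%:R * K%:R) / 2) <= p m y * ln (p m y / r y).
  have v0 : 0 <= (d y == m)%:R * K%:R :> R by rewrite mulr_ge0.
  have [->|pN0] := eqVneq (p m y) 0.
    rewrite !mul0r addr0 sub0r oppr_le0 mulr_ge0 // divr_ge0 //; lra.
  have pp : 0 < p m y by rewrite lt0r pN0 p0.
  have rp : 0 < r y by rewrite lt0r r0 (pr _ _ pN0).
  set V : R := if d y == m then K%:R / 2 else 1 / 2.
  have V0 : 0 < V by rewrite /V; case: ifP => _; rewrite divr_gt0.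
  have lV : ln V = (d y == m)%:R * ln K%:R - ln 2.
    by rewrite /V; case: ifP => _; rewrite ln_div ?posrE // ?mul1r ?mul0r ?ln1.
  (* For each y the right side sums over m to exactly [K]. *)
  have VV : V <= (1 + (d y == m)%:R * K%:R) / 2.
    by rewrite /V; case: ifP => _; rewrite ler_pM2r ?invr_gt0 //;
       rewrite ?mul1r ?mul0r ?addr0 // lerDr.
  have := gibbs_term pp (mulr_gt0 rp V0).
  have -> : ln (p m y / (r y * V)) = ln (p m y / r y) - ln V.
    by rewrite invfM mulrA [LHS]ln_div ?posrE ?divr_gt0.
  rewrite lV.
  have := ler_wpM2l (ltW rp) VV; lra.
have : K%:R^-1 * \sum_m \sum_y (p m y * ((d y == m)%:R * ln K%:R - ln 2)
    + p m y - r y * ((1 + (d y == m)%:R * K%:R) / 2))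
  <= K%:R^-1 * \sum_m \sum_y p m y * ln (p m y / r y).
  rewrite ler_pM2l ?invr_gt0 //.
  by apply: ler_sum => m _; apply: ler_sum => y _; exact: term.
apply: le_trans.
rewrite [X in _ <= _ * X](eq_bigr (fun m =>
    \sum_y p m y * ((d y == m)%:R * ln K%:R - ln 2) + 1
    - \sum_y r y * ((1 + (d y == m)%:R * K%:R) / 2))); last first.
  by move=> m _; rewrite sumrB big_split /= p1.
rewrite sumrB big_split /= sumr_const card_ord.
have -> : \sum_m \sum_y p m y * ((d y == m)%:R * ln K%:R - ln 2) =
   (K%:R - \sum_m \sum_y p m y * (d y != m)%:R) * ln K%:R - K%:R * ln 2 :> R.
  have -> : K%:R = \sum_(m < K) \sum_y p m y :> R.
    by rewrite (eq_bigr _ (fun m _ => p1 m)) sumr_const card_ord.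
  set LK := ln _; rewrite -sumrB !mulr_suml -sumrB; apply: eq_bigr => m _.
  rewrite -sumrB !mulr_suml -sumrB; apply: eq_bigr => y _.
  by case: (d y == m) => /=; ring.
have : \sum_m \sum_y r y * ((1 + (d y == m)%:R * K%:R) / 2) <= K%:R.
  rewrite exchange_big /=.
  rewrite (eq_bigr (fun y => r y * K%:R)).
    by rewrite -mulr_suml ler_piMl.
  move=> y _; rewrite -mulr_sumr; congr (_ * _).
  rewrite -mulr_suml big_split /= sumr_const card_ord -mulr_suml.
  rewrite (bigD1 (d y)) //= eqxx big1 ?addr0; last first.
    by move=> m /negbTE; rewrite eq_sym => ->.
  by rewrite mul1r -mulr2n -(mulr_natr K%:R) mulfK ?pnatr_eq0.
set X := \sum_m \sum_y r y * _; set E := \sum_m \sum_y _ => HX.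
have -> : K%:R^-1 * ((K%:R - E) * ln K%:R - K%:R * ln 2 + K%:R - X) =
  (1 - K%:R^-1 * E) * ln K%:R - ln 2 + (1 - X / K%:R).
  by field.
rewrite lerDl subr_ge0 ler_pdivrMr //; lra.
Qed.

(** * Output laws of codes *)

Lemma take_rcons (T : Type) (s : seq T) x k :
  (k <= size s)%N -> take k (rcons s x) = take k s.
Proof. by move=> ks; rewrite -cats1 takel_cat. Qed.

Lemma gUF N q : gU N q false = minn q.+1 N. Proof. by []. Qed.

Lemma foldl_gU_le N q h : (q <= N)%N -> (foldl (gU N) q h <= N)%N.
Proof.
move=> qN; elim/last_ind: h => //= h x _.
by rewrite foldl_rcons /gU; case: x => //; rewrite geq_minr.
Qed.

Lemma gUo_val N (q : 'I_N.+1) x : gUo q x = gU N q x :> nat.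
Proof. by rewrite inordK // ltnS /gU; case: x => //; rewrite geq_minr. Qed.

(** Until the first 1 a counter started at N stays there; from then on it coincides with the counter
    started at 0. *)
Lemma foldl_gU_full N h : foldl (gU N) N h = N \/
  foldl (gU N) N h = foldl (gU N) 0%N h.
Proof.
elim/last_ind: h => [|h x IH]; first by left.
rewrite !foldl_rcons; case: x; first by right.
by case: IH => ->; [left; rewrite gUF; lia|right].
Qed.

Section PUlemmas.
Variables (R : realType) (N : nat) (eta : R).

Lemma PU_sum x s q : \sum_sp PU N eta sp x s q = 1.
Proof.
rewrite big_bool /PU /behc; case: ifP => _ /=; first by rewrite addr0.
by rewrite subrK.
Qed.

Lemma PU_ge0 sp x s q : 0 <= eta <= 1 -> 0 <= PU N eta sp x s q.
Proof.
move=> /andP[e0 e1]; rewrite /PU /behc; case: ifP => _ //.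
by case: sp; case: (x == s) => /=; lra.
Qed.

Lemma PU_true q : PU N eta true true true q = eta.
Proof. by rewrite /PU /behc andbF /=; lra. Qed.

Lemma PU_boost s q : (q == N.-1) || (q == N) -> PU N eta true false s q = 1.
Proof. by rewrite /PU => ->. Qed.

Lemma PU_false s q : ~~ ((q == N.-1) || (q == N)) ->
  PU N eta true false s q = if s then 1 else eta.
Proof. by rewrite /PU /behc => /negbTE -> /=; case: s => /=; lra. Qed.

End PUlemmas.

Section Law.
Variables (R : realType) (N : nat) (eta : R).

(* For an output law [p], [charged p h] is the joint probability of output
   history [h] and a charged battery, when the run starts from S = 1, Q = N
   and each X is drawn from S and the past outputs only. *)
Fixpoint charged_rev (p : seq bool -> R) (r : seq bool) : R :=
  if r isn't x :: r' then 1 else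
  if x then eta * p (rev r) else
  let q := foldl (gU N) N (rev r') in
  if (q == N.-1) || (q == N) then p (rev r)
  else (1 - eta) * charged_rev p r' + eta * p (rev r') - p (rev (true :: r')).

Definition charged p h := charged_rev p (rev h).

Lemma charged_rcons1 p h : charged p (rcons h true) = eta * p (rcons h true).
Proof. by rewrite /charged rev_rcons /= rev_cons revK. Qed.

(** Outside the boosted case, sending 0 keeps the charged mass [charged p h - p (rcons h true)] and
    charges the empty mass [p h - charged p h] with probability [eta]. *)
Lemma charged_rcons0 p h : charged p (rcons h false) =
  let q := foldl (gU N) N h in
  if (q == N.-1) || (q == N) then p (rcons h false)
  else (1 - eta) * charged p h + eta * p h - p (rcons h true).
Proof. by rewrite /charged rev_rcons /= !rev_cons !revK. Qed.

(** The last clause is the input constraint: a 1 can only be sent from a charged battery. It is what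
    makes [send] below a probability. *)
Definition feasible (p : seq bool -> R) :=
  [/\ p [::] = 1, forall h, 0 <= p h,
      forall h, p (rcons h true) + p (rcons h false) = p h &
      forall h, p (rcons h true) <= charged p h].

Lemma charged_ge0 p h : feasible p -> 0 <= charged p h.
Proof. by move=> [_ p0 _ pc]; apply: le_trans (pc h). Qed.

Lemma charged_le p h : 0 <= eta <= 1 -> feasible p -> charged p h <= p h.
Proof.
move=> /andP[e0 e1] [p1 p0 pD pc].
elim/last_ind: h => [|h [] IH]; first by rewrite p1.
  by rewrite charged_rcons1 ler_piMl.
rewrite charged_rcons0 /=; case: ifP => _ //.
have e1' : 0 <= 1 - eta by rewrite subr_ge0.
by have := pD h; have := ler_wpM2l e1' IH; lra.
Qed.

Lemma sum_law p k : feasible p -> \sum_(y : k.-tuple bool) p y = 1.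
Proof.
move=> [p1 _ pD _]; elim: k => [|k IH].
  rewrite (big_pred1 [tuple]) //= => t; apply/esym/eqP.
  by rewrite (tuple0 t).
rewrite big_tuple_rcons -[RHS]IH; apply: eq_bigr => t _.
by rewrite big_bool /= pD.
Qed.

Lemma law_le1 p h : feasible p -> p h <= 1.
Proof.
move=> fp; have [_ p0 _ _] := fp; rewrite -(sum_law (size h) fp).
by rewrite (bigD1 (in_tuple h)) //= lerDl sumr_ge0.
Qed.

End Law.

Section CodeLaw.
Variables (R : realType) (N : nat) (eta : R).
Hypothesis etaP : 0 <= eta <= 1.
Variables (n K : nat) (c : Defs.code n K) (m : 'I_K).

Lemma size_inputs ss k : size (inputs c m ss k) = k.
Proof. by elim: k => //= k IH; rewrite size_rcons IH. Qed.

Lemma inputs_rcons ss s k : (k <= size ss)%N ->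
  inputs c m (rcons ss s) k = inputs c m ss k.
Proof.
elim: k => //= k IH lt; rewrite IH ?(ltnW lt) //.
by rewrite take_rcons // ltnW.
Qed.

(** [traj_prob] with a free length, so that induction over time is possible. *)
Definition traj (k : nat) (ss : seq bool) : R :=
  let xs := inputs c m ss k in
  \prod_(i < k) PU N eta (nth false ss i) (nth false xs i)
    (nth false (false :: ss) i) (foldl (gU N) 0%N (take i xs)).

Definition next (ss : seq bool) := enc c (size ss) m ss (inputs c m ss (size ss)).

Lemma traj_rcons k (ss : seq bool) s : size ss = k ->
  traj k.+1 (rcons ss s) = traj k ss *
   PU N eta s (next ss) (last false ss) (foldl (gU N) 0%N (inputs c m ss k)).
Proof.
move=> sz; rewrite /traj /next big_ord_recr /= inputs_rcons ?sz //.
have tk : take k (rcons ss s) = ss by rewrite take_rcons -?sz // take_size.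
congr (_ * _).
  apply: eq_bigr => i _.
  have il : (i < size ss)%N by rewrite sz.
  have ix : (i < size (inputs c m ss k))%N by rewrite size_inputs.
  rewrite !nth_rcons il ix -rcons_cons nth_rcons /= ltnS (ltnW il).
  by rewrite take_rcons // ltnW.
rewrite tk nth_rcons sz ltnn eqxx nth_rcons size_inputs ltnn eqxx.
rewrite -rcons_cons nth_rcons /= sz leqnn.
have -> : take k (rcons (inputs c m ss k) (enc c k m ss (inputs c m ss k))) =
   inputs c m ss k by rewrite take_rcons ?size_inputs //
     take_oversize ?size_inputs.
by rewrite (last_nth false) sz.
Qed.

Lemma traj_ge0 k ss : 0 <= traj k ss.
Proof. by apply: prodr_ge0 => i _; apply: PU_ge0. Qed.

Definition law_state (h : seq bool) (s : bool) : R :=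
  \sum_(ss : (size h).-tuple bool)
    traj (size h) ss * (inputs c m ss (size h) == h)%:R
    * (last false ss == s)%:R.

Definition law_next (h : seq bool) (s x : bool) : R :=
  \sum_(ss : (size h).-tuple bool)
    traj (size h) ss * (inputs c m ss (size h) == h)%:R
    * (last false ss == s)%:R * (next ss == x)%:R.

Definition law (h : seq bool) : R := \sum_s law_state h s.

(** The inputs are a function of the battery states, so trajectories can be grouped by the outputs
    they produce. *)
Lemma law_sum (k : nat) (g : seq bool -> R) :
  \sum_(ss : k.-tuple bool) traj k ss * g (inputs c m ss k) =
  \sum_(y : k.-tuple bool) law y * g y.
Proof.
transitivity (\sum_(y : k.-tuple bool) \sum_(ss : k.-tuple bool)
   traj k ss * (inputs c m ss k == y)%:R * g y).
  rewrite exchange_big /=; apply: eq_bigr => ss _.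
  have sz : size (inputs c m ss k) == k by rewrite size_inputs.
  rewrite (bigD1 (Tuple sz)) //= eqxx mulr1 big1 ?addr0 // => y yN.
  case: eqP => [e|_]; last by rewrite mulr0 mul0r.
  by case/eqP: yN; apply: val_inj; rewrite /= e.
apply: eq_bigr => y _; rewrite -mulr_suml; congr (_ * _).
rewrite /law /law_state size_tuple exchange_big /=; apply: eq_bigr => ss _.
rewrite -mulr_sumr big_bool /=.
by case: (last _ _); rewrite /= ?addr0 ?add0r mulr1.
Qed.

Lemma law_state_ge0 h s : 0 <= law_state h s.
Proof. by apply: sumr_ge0 => ss _; rewrite !mulr_ge0 ?traj_ge0. Qed.

Lemma law_next_ge0 h s x : 0 <= law_next h s x.
Proof. by apply: sumr_ge0 => ss _; rewrite !mulr_ge0 ?traj_ge0. Qed.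

Lemma law_next_sum h s :
  law_next h s true + law_next h s false = law_state h s.
Proof.
rewrite -big_split /=; apply: eq_bigr => ss _.
by rewrite -mulrDr; case: (next ss); rewrite /= ?addr0 ?add0r mulr1.
Qed.

Lemma law_next0 h : law_next h false true = 0.
Proof.
apply: big1 => ss _; have := enc_ok c (size ss) m ss (inputs c m ss (size ss)).
rewrite -/(next ss); case: (next ss); last by rewrite mulr0.
by move=> /= ->; rewrite mulr0 mul0r.
Qed.

(** The outputs determine Q; hence, given them, one channel use is a Markov step on the battery
    alone. *)
Lemma law_state_rcons h x s' : law_state (rcons h x) s' =
  \sum_s law_next h s x * PU N eta s' x s (foldl (gU N) 0%N h).
Proof.
rewrite /law_state size_rcons (big_tuple_rcons _ (fun ss : seq bool =>
  traj (size h).+1 ss * (inputs c m ss (size h).+1 == rcons h x)%:R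
  * (last false ss == s')%:R)) /law_next.
under [RHS]eq_bigr do rewrite mulr_suml.
rewrite [RHS]exchange_big /=; apply: eq_bigr => ss _.
have sz := size_tuple ss.
have nx : next ss = enc c (size h) m ss (inputs c m ss (size h)).
  by rewrite /next sz.
transitivity (traj (size h) ss * (inputs c m ss (size h) == h)%:R *
  (next ss == x)%:R * PU N eta s' x (last false ss) (foldl (gU N) 0%N h)).
  under eq_bigr => s _.
    rewrite traj_rcons // inputs_rcons ?sz // last_rcons.
    have -> : take (size h) (rcons ss s) = ss.
      by rewrite take_rcons -?{1}sz // take_oversize ?sz.
    rewrite eqseq_rcons -nx.
    over.
  case: eqP => [->|_]; last first.
    by rewrite !(mulr0, mul0r) big1 // => s _; rewrite /= mulr0 mul0r.
  case: eqP => [->|_] /=; last first.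
    by rewrite !(mulr0, mul0r) big1 // => s _; rewrite /= mulr0 mul0r.
  rewrite (bigD1 s') //= eqxx big1 ?addr0; last first.
    by move=> s /negbTE ->; rewrite mulr0.
  by rewrite !mulr1.
by rewrite big_bool; case: (last false ss) => /=; ring.
Qed.

Lemma law_rcons h x : law (rcons h x) = \sum_s law_next h s x.
Proof.
rewrite /law; under eq_bigr do rewrite law_state_rcons.
rewrite exchange_big /=; apply: eq_bigr => s _.
by rewrite -mulr_sumr PU_sum mulr1.
Qed.

Lemma law_rcons1 h : law (rcons h true) = law_next h true true.
Proof. by rewrite law_rcons big_bool /= law_next0 addr0. Qed.

Lemma law_ge0 h : 0 <= law h.
Proof. by apply: sumr_ge0 => s _; exact: law_state_ge0. Qed.

Lemma law_sumD h : law (rcons h true) + law (rcons h false) = law h.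
Proof.
rewrite !law_rcons /law -big_split /=; apply: eq_bigr => s _.
by rewrite law_next_sum.
Qed.

Lemma law_nil s : law_state [::] s = (s == false)%:R.
Proof.
rewrite /law_state (big_pred1 [tuple]) /=; last first.
  by move=> t; apply/esym/eqP; rewrite (tuple0 t).
by rewrite /traj big_ord0 /= !mul1r eq_sym.
Qed.

(* Starting with more energy, and boosting at least as often, can only make
   the battery more likely to be charged given the same outputs. *)
Lemma law_state_le h : law_state h true <= charged N eta law h.
Proof.
case/andP: (etaP) => e0 e1.
elim/last_ind: h => [|h [] IH].
- by rewrite law_nil.
- by rewrite charged_rcons1 law_rcons1 law_state_rcons big_bool /= law_next0 mul0r
    addr0 PU_true mulrC.
rewrite charged_rcons0 /=; case: ifP => bq.
  by rewrite /law big_bool /= lerDl law_state_ge0.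
have [q'N|q'q] := foldl_gU_full N h; first by rewrite q'N eqxx orbT in bq.
rewrite law_state_rcons big_bool /= -q'q !PU_false ?bq //.
have := law_next_sum h true; have := law_next_sum h false.
have lE : law h = law_state h true + law_state h false by rewrite /law big_bool.
rewrite law_next0 law_rcons1 lE => Ef Et.
have e1' : 0 <= 1 - eta by rewrite subr_ge0.
(* In the unboosted case the charged mass a is updated to (1 - eta) a + eta p - a1, with p the mass
   of [h] and a1 that of a further 1; this is monotone in a. *)
have := ler_wpM2l e1' IH.
set a := law_state h true in Et *; set b := law_state h false in Ef *.
set a1 := law_next h true true in Et *; set a0 := law_next h true false in Et *.
set b0 := law_next h false false in Ef *.
have -> : a0 = a - a1 by lra.
have -> : b0 = b by lra.
lra.
Qed.

Lemma law_feasible : feasible N eta law.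
Proof.
split=> [|h|h|h].
- by rewrite /law big_bool !law_nil /= add0r.
- exact: law_ge0.
- exact: law_sumD.
rewrite law_rcons1; apply: le_trans (law_state_le h).
by rewrite -law_next_sum lerDl law_next_ge0.
Qed.

End CodeLaw.

Lemma truncate_ok n K (c : Defs.code n K) (i : nat) (m : 'I_K)
    (ss ys : seq bool) :
  ((i < n)%N && enc c i m ss ys) ==> last false ss.
Proof.
by apply/implyP => /andP[_]; apply/implyP; exact: enc_ok.
Qed.

(** Silent from time [n] on. The first [n] inputs, and so the error probability, do not change,
    while the law now describes a block followed by zeros. *)
Definition truncate n K (c : Defs.code n K) : Defs.code n K :=
  @Code n K _ (dec c) (truncate_ok c).

Lemma inputs_truncate n K (c : Defs.code n K) m ss k : (k <= n)%N ->
  inputs (truncate c) m ss k = inputs c m ss k.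
Proof. by elim: k => //= k IH kn; rewrite IH ?kn // ltnW. Qed.

Lemma code_law (R : realType) (N : nat) (eta : R) n K (c : Defs.code n K) :
  0 <= eta <= 1 ->
  exists p : 'I_K -> seq bool -> R,
   [/\ forall m, feasible N eta (p m),
       forall m h, (n <= size h)%N -> p m (rcons h true) = 0 &
       err_prob N eta c = K%:R^-1 *
         \sum_m \sum_(y : n.-tuple bool) p m y * (dec c y != m)%:R].
Proof.
move=> etaP; exists (fun m => law N eta (truncate c) m); split.
- by move=> m; apply: law_feasible.
- move=> m h nh; rewrite law_rcons1 //; apply: big1 => ss _.
  by rewrite /next /= size_tuple ltnNge nh /= mulr0.
rewrite /err_prob; congr (_ * _); apply: eq_bigr => m _.
rewrite -(law_sum N eta (truncate c) m n (fun y => (dec c y != m)%:R)).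
apply: eq_bigr => ss _; rewrite inputs_truncate //; congr (_ * _).
by rewrite /traj inputs_truncate.
Qed.

(** * The cyclic policy *)

Lemma big_option (V : nmodType) (T : finType) (F : option T -> V) :
  \sum_u F u = F None + \sum_t F (Some t).
Proof.
rewrite (bigD1 None) //=; congr (_ + _).
rewrite (reindex_omap Some id) /=; last by case.
by apply: eq_bigl => t; rewrite eqxx.
Qed.

Lemma sum_pair (V : nmodType) (A B : finType) (F : A * B -> V) :
  \sum_t F t = \sum_a \sum_b F (a, b).
Proof. by rewrite pair_bigA; apply: eq_bigr => -[]. Qed.

Lemma sum_mul_eq (R : pzSemiRingType) (T : finType) (t0 : T) (F : T -> R) :
  \sum_t F t * (t == t0)%:R = F t0.
Proof.
rewrite (bigD1 t0) //= eqxx mulr1 big1 ?addr0 // => t /negbTE ->.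
by rewrite mulr0.
Qed.

Lemma sum_state (V : nmodType) (A B D : finType) (F : A * B * D -> V) :
  \sum_z F z = \sum_a \sum_b \sum_d F (a, b, d).
Proof. by rewrite sum_pair sum_pair. Qed.

Lemma kernelT_sum (R : realType) (U : finType) N (eta : R) f
    (P : U -> 'I_N.+1 -> U -> R) z :
  policy P -> \sum_zp kernelT eta f P z zp = 1.
Proof.
move=> [_ P1]; case: z => [[s u] q]; rewrite sum_state -[RHS](P1 u q).
rewrite exchange_big /=; apply: eq_bigr => up _.
rewrite exchange_big /=.
under eq_bigr do rewrite exchange_big /=.
rewrite exchange_big /=.
transitivity (\sum_x P u q up * (x == f up s)%:R * \sum_qp (qp == gUo q x)%:R).
  apply: eq_bigr => x _; rewrite mulr_sumr; apply: eq_bigr => qp _.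
  by rewrite -mulr_sumr PU_sum mulr1.
transitivity (\sum_x P u q up * (x == f up s)%:R).
  apply: eq_bigr => x _; rewrite (bigD1 (gUo q x)) //= eqxx big1 ?addr0 ?mulr1 //.
  by move=> i /negbTE ->.
by rewrite sum_mul_eq.
Qed.

Lemma kernelT_neq0 (R : realType) (U : finType) N (eta : R) f
    (P : U -> 'I_N.+1 -> U -> R) s u q sp up qp :
  kernelT eta f P (s, u, q) (sp, up, qp) != 0 ->
  [/\ P u q up != 0, qp = gUo q (f up s) & PU N eta sp (f up s) s q != 0].
Proof.
rewrite /kernelT (bigD1 (f up s)) //= eqxx mulr1 big1 ?addr0; last first.
  by move=> x /negbTE ->; rewrite mulr0 !mul0r.
case: (eqVneq qp (gUo q (f up s))) => [->|_]; last by rewrite mulr0 mul0r eqxx.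
by rewrite mulr1 mulf_eq0 negb_or => /andP[].
Qed.

(** Chain rule for the divergence of [p] from [r], where [rr] gives the conditional weights of [r].
    Positivity of [rr] on the support of [p] keeps all logarithms genuine. *)
Lemma chain_rule (R : realType) (p r : seq bool -> R)
    (rr : seq bool -> bool -> R) (n : nat) :
  p [::] = 1 -> (forall h, 0 <= p h) ->
  (forall h, p (rcons h true) + p (rcons h false) = p h) ->
  r [::] = 1 -> (forall h x, r (rcons h x) = r h * rr h x) ->
  (forall h x, (size h < n)%N -> p (rcons h x) != 0 -> 0 < rr h x) ->
  (forall h, (size h <= n)%N -> p h != 0 -> 0 < r h) /\
  \sum_(y : n.-tuple bool) p y * ln (p y / r y) =
  \sum_(k < n) \sum_(h : k.-tuple bool) \sum_x
     p (rcons h x) * ln (p (rcons h x) / p h / rr h x).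
Proof.
move=> p1 p0 pD r1 rD rp.
have pN0 h x : p (rcons h x) != 0 -> p h != 0.
  rewrite -(pD h) paddr_eq0 // negb_and.
  by case: x => ->; rewrite ?orbT.
have rpos h : (size h <= n)%N -> p h != 0 -> 0 < r h.
  elim/last_ind: h => [|h x IH]; first by rewrite r1.
  rewrite size_rcons => hn px; rewrite rD mulr_gt0 ?rp //.
  by rewrite IH ?(ltnW hn) // (pN0 _ _ px).
split=> //.
have {}rp h x : (size h < n)%N -> p (rcons h x) != 0 -> 0 < rr h x by exact: rp.
elim: n rp rpos => [|n IH] rp rpos.
  rewrite big_ord0 (big_pred1 [tuple]) /=.
    by rewrite p1 r1 divr1 ln1 mulr0.
  by move=> t; apply/esym/eqP; rewrite (tuple0 t).
rewrite big_ord_recr /= -IH; last 2 first.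
- by move=> h x hn; apply: rp; rewrite ltnW.
- by move=> h hn; apply: rpos; rewrite ltnW.
rewrite (big_tuple_rcons n (fun y => p y * ln (p y / r y))) -big_split /=.
apply: eq_bigr => h _.
have -> : p h * ln (p h / r h) = \sum_x p (rcons h x) * ln (p h / r h).
  by rewrite -mulr_suml big_bool /= pD.
rewrite -big_split /=; apply: eq_bigr => x _.
have [->|px] := eqVneq (p (rcons h x)) 0; first by rewrite !mul0r addr0.
have hn : (size h < n.+1)%N by rewrite size_tuple.
have pos z : p z != 0 -> 0 < p z by rewrite lt0r p0 andbT.
have P1 := pos _ px; have P2 := pos _ (pN0 _ _ px).
have P3 := rpos h (ltnW hn) (pN0 _ _ px); have P4 := rp h x hn px.
rewrite -mulrDr -lnM ?posrE ?divr_gt0 // rD; congr (_ * ln _).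
by field; rewrite !gt_eqF.
Qed.

Section Policy.
Variables (R : realType) (N : nat) (eta : R).
Hypothesis etaP : 0 <= eta <= 1.
Hypothesis N0 : (0 < N)%N.
Variables (n K : nat) (p : 'I_K -> seq bool -> R).
Hypothesis K0 : (0 < K)%N.
Hypothesis p_feasible : forall m, feasible N eta (p m).
Hypothesis p_stop : forall m h, (n <= size h)%N -> p m (rcons h true) = 0.

(* A state [Some (m, h, a)] records the message, the outputs so far and the
   strategy X = a && S of the current step; after [M.+1] steps, of which the
   last [N.+1] transmit 0, the state [None] forgets everything (sending one
   more 0), so that the chain is back at S = 1, Q = N. *)
Let M := (n + N)%N.
Let C := M.+2.
Let U : finType := option ('I_K * M.-bseq bool * bool).
Let cnt (h : seq bool) : nat := foldl (gU N) N h.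
Let ch m := charged N eta (p m).

(* The joint probability of outputs [h] and S = [s], started at S = 1, Q = N. *)
Definition wt m h (s : bool) : R := if s then ch m h else p m h - ch m h.

(** Law of the strategy bit: its chance of being 1 is that of sending 1 given a charged battery.
    Where [ch m h] vanishes the quotient is 0 by convention. *)
Definition send m h (a : bool) : R :=
  let r := p m (rcons h true) / ch m h in if a then r else 1 - r.
Arguments send : simpl never.

Definition shannon (u : U) (s : bool) : bool :=
  if u is Some (_, _, a) then a && s else false.

(** The test [q == ord0] reads off the last output and appends it to the history. After the reset a
    fresh uniform message is drawn. *)
Definition cycle_policy (u : U) (q : 'I_N.+1) (u' : U) : R :=
  match u, u' with
  | None, None => 0
  | None, Some (m, h, a) => K%:R^-1 * (h == [::] :> seq bool)%:R * send m h a
  | Some (_, h, _), None => (size h == M)%:R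
  | Some (m, h, _), Some (m', h', a) =>
      (m' == m)%:R * (h' == rcons h (q == ord0) :> seq bool)%:R * send m' h' a
  end.

(* The stationary law of (S, Q, U^+), before the step is taken. *)
Definition prelaw (s : bool) (q : 'I_N.+1) (u : U) : R :=
  match u with
  | None => C%:R^-1 * s%:R * (q == ord_max)%:R
  | Some (m, h, a) =>
      (K%:R * C%:R)^-1 * (wt m h s * send m h a) * (q == cnt h :> nat)%:R
  end.

(** One channel use applied to [prelaw]: here the second component is the strategy that has just
    been used. *)
Definition cycle_law (z : bool * U * 'I_N.+1) : R :=
  let: (s', u, q') := z in
  \sum_s \sum_q \sum_x prelaw s q u * (x == shannon u s)%:R
    * (q' == gUo q x)%:R * PU N eta s' x s q.
Arguments cycle_law : simpl never.

(** * Realising the output laws by strategies; stationarity *)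

Lemma p_ge0 m h : 0 <= p m h. Proof. by case: (p_feasible m). Qed.

Lemma pD m h : p m (rcons h true) + p m (rcons h false) = p m h.
Proof. by case: (p_feasible m). Qed.

Lemma p_ch m h : p m (rcons h true) <= ch m h.
Proof. by case: (p_feasible m). Qed.

Lemma ch_ge0 m h : 0 <= ch m h. Proof. exact: charged_ge0. Qed.

Lemma wt_ge0 m h s : 0 <= wt m h s.
Proof. by case: s; rewrite /= ?ch_ge0 // subr_ge0 charged_le. Qed.

Lemma ch_send m h : ch m h * send m h true = p m (rcons h true).
Proof.
rewrite /send; have [c0|cN0] := eqVneq (ch m h) 0.
  by rewrite c0 mul0r; apply/le_anti; rewrite p_ge0 -c0 p_ch.
by rewrite mulrC divfK.
Qed.

Lemma send_ge0 m h a : 0 <= send m h a.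
Proof.
rewrite /send; case: a; first by rewrite divr_ge0 ?p_ge0 ?ch_ge0.
rewrite subr_ge0; have [->|cN0] := eqVneq (ch m h) 0.
  by rewrite invr0 mulr0.
by rewrite ler_pdivrMr ?mul1r ?p_ch // lt0r cN0 ch_ge0.
Qed.

Lemma send_sum m h : \sum_a send m h a = 1.
Proof. by rewrite big_bool /= /send addrC subrK. Qed.

Lemma send_stop m h : (n <= size h)%N -> send m h true = 0.
Proof. by move=> nh; rewrite /send p_stop // mul0r. Qed.

Lemma sum_wt m h : \sum_s wt m h s = p m h.
Proof. by rewrite big_bool /= addrC subrK. Qed.

Lemma wt_out m h x :
  \sum_a \sum_s wt m h s * send m h a * (x == a && s)%:R = p m (rcons h x).
Proof.
have cs := ch_send m h.
have s1 : send m h false = 1 - send m h true by [].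
by have := pD m h; rewrite !big_bool /=; case: x => /=; rewrite s1; lra.
Qed.

(** Realisability: with strategies drawn by [send], independently of the battery given the outputs,
    the joint law of outputs and battery obeys the recursion that defines [charged]. *)
Lemma wt_step m h x s' :
  \sum_a \sum_s wt m h s * send m h a * (x == a && s)%:R
     * PU N eta s' x s (cnt h) = wt m (rcons h x) s'.
Proof.
have cs := ch_send m h.
have s1 : send m h false = 1 - send m h true by [].
suff Ht : \sum_a \sum_s wt m h s * send m h a * (x == a && s)%:R
     * PU N eta true x s (cnt h) = ch m (rcons h x).
  case: s' => //=; rewrite -Ht.
  rewrite -(wt_out m h x) -sumrB; apply: eq_bigr => a _.
  rewrite -sumrB; apply: eq_bigr => s _.
  have := PU_sum N eta x s (cnt h); rewrite big_bool /= => H.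
  have -> : PU N eta false x s (cnt h) = 1 - PU N eta true x s (cnt h) by lra.
  by ring.
rewrite !big_bool /=; case: x => /=.
  rewrite /ch charged_rcons1 PU_true; move: cs; rewrite /ch => <-; ring.
rewrite /ch charged_rcons0 -/(cnt h) /= -/(ch m); case: ifP => bq.
  rewrite !PU_boost ?bq //; have := pD m h.
  by rewrite s1 -cs; lra.
rewrite !PU_false ?bq // s1 -cs; ring.
Qed.

Lemma cnt_le h : (cnt h <= N)%N.
Proof. exact: foldl_gU_le. Qed.

Lemma gUo_cnt (q : 'I_N.+1) (q' : 'I_N.+1) h x : q = cnt h :> nat ->
  (q' == gUo q x) = (q' == cnt (rcons h x) :> nat).
Proof. by move=> e; rewrite -val_eqE /= gUo_val e /cnt foldl_rcons. Qed.

Lemma cycle_law_some m h q s' :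
  \sum_b cycle_law (s', Some (m, h, b), q) =
  (K%:R * C%:R)^-1 *
    \sum_x wt m (rcons h x) s' * (q == cnt (rcons h x) :> nat)%:R.
Proof.
rewrite /cycle_law.
transitivity (\sum_b \sum_s \sum_x (K%:R * C%:R)^-1 * (wt m h s * send m h b)
   * (x == b && s)%:R * (q == cnt (rcons h x) :> nat)%:R
   * PU N eta s' x s (cnt h)).
  apply: eq_bigr => b _; apply: eq_bigr => s _.
  have ltq : (cnt h < N.+1)%N by rewrite ltnS cnt_le.
  rewrite (bigD1 (Ordinal ltq)) //= [X in _ + X]big1 ?addr0; last first.
    move=> q0; rewrite -val_eqE /= => /negbTE ->.
    by apply: big1 => x _; rewrite mulr0 !mul0r.
  apply: eq_bigr => x _; rewrite eqxx mulr1.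
  by rewrite (@gUo_cnt _ _ h).
under eq_bigr do rewrite exchange_big /=.
rewrite exchange_big /= mulr_sumr; apply: eq_bigr => x _.
rewrite -wt_step mulr_suml mulr_sumr; apply: eq_bigr => b _.
by rewrite mulr_suml mulr_sumr; apply: eq_bigr => s _; ring.
Qed.

Lemma gUo_max : gUo (ord_max : 'I_N.+1) false = ord_max.
Proof. by apply: val_inj; rewrite /= gUo_val gUF /=; lia. Qed.

(** The reset sends a 0 at Q = N, which charges surely and leaves Q at N. *)
Lemma cycle_law_none s q :
  cycle_law (s, None, q) = C%:R^-1 * s%:R * (q == ord_max)%:R.
Proof.
rewrite /cycle_law big_bool /= [X in _ + X]big1 ?addr0; last first.
  by move=> q0 _; apply: big1 => x _; rewrite mulr0n mulr0 !mul0r.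
rewrite (bigD1 ord_max) //= [X in _ + X]big1 ?addr0; last first.
  by move=> q0 /negbTE ->; apply: big1 => x _; rewrite mulr0n mulr0 !mul0r.
rewrite big_bool /= !eqxx mulr0 !mul0r add0r gUo_max !mulr1.
have PUs : PU N eta s false true N = s%:R.
  by rewrite /PU eqxx orbT; case: s.
by rewrite PUs mulrAC.
Qed.

(** As N > 0, a 0 leaves the counter positive, so Q reveals the last output. *)
Lemma cnt_zeros h x : (cnt (rcons h x) == 0%N) = x.
Proof.
rewrite /cnt foldl_rcons; case: x; first by [].
by rewrite gUF; case: (N) N0 => // N' _; rewrite minnSS.
Qed.

(** From time [n] on only zeros have positive probability, and each raises the counter until it is
    full. *)
Lemma cnt_late m h : p m h != 0 -> (minn (size h - n) N <= cnt h)%N.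
Proof.
elim/last_ind: h => [|h x IH]; first by rewrite sub0n min0n.
have [nh|nh] := leqP n (size h); last first.
  by rewrite size_rcons (eqP nh) min0n.
case: x; first by rewrite p_stop // eqxx.
move=> pN0; have := IH; rewrite -(pD m h) p_stop // add0r => /(_ pN0).
rewrite /cnt foldl_rcons gUF size_rcons; lia.
Qed.

Lemma sum_bseq_size (k : nat) (F : seq bool -> R) : (k <= M)%N ->
  \sum_(h : M.-bseq bool) (size h == k)%:R * F h = \sum_(t : k.-tuple bool) F t.
Proof.
move=> kM; rewrite (big_bseq _ (fun h : seq bool => (size h == k)%:R * F h)).
have kM' : (k < M.+1)%N by [].
rewrite (bigD1 (Ordinal kM')) //= [X in _ + X]big1 ?addr0.
  by apply: eq_bigr => t _; rewrite size_tuple eqxx mul1r.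
move=> i; rewrite -val_eqE /= => /negbTE iN; apply: big1 => t _.
by rewrite size_tuple iN mul0r.
Qed.

Lemma big_state (F : U -> R) : \sum_u F u =
  F None + \sum_m \sum_h \sum_b F (Some (m, h, b)).
Proof. by rewrite big_option sum_pair sum_pair. Qed.

Lemma KC_unit : K%:R != 0 :> R /\ C%:R != 0 :> R.
Proof. by rewrite !pnatr_eq0 -lt0n. Qed.

(** After N silent steps the counter is full, so one more 0 charges the battery surely and leaves Q
    at N. *)
Lemma wt_end m h s q : size h = M ->
  \sum_x wt m (rcons h x) s * (q == cnt (rcons h x) :> nat)%:R
  = p m h * s%:R * (q == N)%:R.
Proof.
move=> szh; have nh : (n <= size h)%N by rewrite szh leq_addr.
have p0 : p m (rcons h true) = 0 by rewrite p_stop.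
have pf : p m (rcons h false) = p m h by rewrite -(pD m h) p0 add0r.
rewrite big_bool /=.
have -> : wt m (rcons h true) s = 0.
  by case: s; rewrite /= /ch charged_rcons1 p0 ?mulr0 ?subr0.
rewrite mul0r add0r.
(* For an impossible history nothing is known about the counter, but both weights vanish since they
   are nonnegative with sum 0. *)
have [pz|pN0] := eqVneq (p m h) 0.
  rewrite pz !mul0r; have := sum_wt m (rcons h false).
  rewrite pf pz big_bool /= => /eqP.
  have w0 := wt_ge0 m (rcons h false).
  rewrite paddr_eq0 ?(w0 true) ?(w0 false) // => /andP[/eqP e1 /eqP e2].
  by case: s; [move: e1|move: e2] => /= ->; rewrite mul0r.
have cN : cnt h = N.
  have := cnt_late pN0; have := cnt_le h; rewrite szh; lia.
have -> : cnt (rcons h false) = N.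
  by rewrite /cnt foldl_rcons -/(cnt h) cN gUF; lia.
have chp : ch m (rcons h false) = p m h.
  by rewrite /ch charged_rcons0 /= -/(cnt h) cN eqxx orbT.
by case: s; rewrite /= chp ?pf ?subrr ?mulr1 ?mulr0.
Qed.

(** Each new state has one kind of predecessor: the reset comes from histories of length [M], the
    empty history from the reset, and a longer history from its prefix. *)
Lemma cycle_step s q u' :
  \sum_u cycle_law (s, u, q) * cycle_policy u q u' = prelaw s q u'.
Proof.
have [KN0 CN0] := KC_unit.
rewrite big_state cycle_law_none.
case: u' => [[[m h'] a]|] /=; last first.
  rewrite mulr0 add0r.
  transitivity (\sum_(m < K) \sum_(h : M.-bseq bool) (size h == M)%:R *
      ((K%:R * C%:R)^-1 * (p m h * s%:R * (q == N :> nat)%:R))).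
    apply: eq_bigr => m _; apply: eq_bigr => h _.
    rewrite -mulr_suml cycle_law_some mulrC.
    by case: eqP => [e|_]; [rewrite wt_end|rewrite !mul0r].
  rewrite (eq_bigr (fun=> (K%:R * C%:R)^-1 * (s%:R * (q == N :> nat)%:R))).
    by rewrite sumr_const card_ord -mulr_natl -val_eqE /=; field; apply/andP.
  move=> m _; rewrite (sum_bseq_size (fun h : seq bool => (K%:R * C%:R)^-1 *
    (p m h * s%:R * (q == N :> nat)%:R))) // -mulr_sumr -!mulr_suml.
  by rewrite (sum_law _ (p_feasible m)) mul1r.
have [h0|hN] := eqVneq (h' : seq bool) [::].
  rewrite [X in _ + X]big1 ?addr0; last first.
    move=> m' _; apply: big1 => h _; apply: big1 => b _.
    by rewrite h0; case: (h : seq bool) => [|y t]; rewrite /= mulr0 !mul0r mulr0.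
  rewrite h0 /= /cnt /= -[(q : nat) == N]/(q == ord_max).
  have [c1 c2] : wt m [::] true = 1 /\ wt m [::] false = 0.
    rewrite /= /ch /charged /=; case: (p_feasible m) => -> _ _ _.
    by rewrite subrr.
  by case: s; rewrite ?c1 ?c2 ?mulr1n ?mulr0n; field; apply/andP.
rewrite !mulr0 mul0r mulr0 add0r.
have [h [y h'E]] : exists h y, (h' : seq bool) = rcons h y.
  by case/lastP: (h' : seq bool) hN => // h y _; exists h, y.
have szh : (size h <= M)%N.
  by have := size_bseq h'; rewrite h'E size_rcons => /ltnW.
rewrite (bigD1 m) //= [X in _ + X]big1 ?addr0; last first.
  move=> m' /negbTE mN; apply: big1 => h0 _; apply: big1 => b _.
  by rewrite (eq_sym m) mN mulr0n !mul0r mulr0.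
rewrite (bigD1 (Bseq szh)) //= [X in _ + X]big1 ?addr0; last first.
  move=> h0 hN0; apply: big1 => b _; rewrite h'E eqseq_rcons.
  have /negbTE -> : h != h0.
    by apply: contraNneq hN0 => e; apply/eqP/val_inj.
  by rewrite /= mulr0n mulr0 mul0r mulr0.
rewrite -mulr_suml cycle_law_some //= h'E eqseq_rcons eqxx eqxx mul1r /=.
rewrite big_bool /= -[q == ord0]/((q : nat) == 0%N).
(* The last output read from Q is the true one, so the appended letter y equals x. *)
have e x : (q == cnt (rcons h x) :> nat)%:R * (y == ((q : nat) == 0%N))%:R
   = (x == y)%:R * (q == cnt (rcons h x) :> nat)%:R :> R.
  case: eqP => [->|_]; last by rewrite mul0r mulr0.
  by rewrite cnt_zeros // mulr1 mul1r eq_sym.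
transitivity ((K%:R * C%:R)^-1 * send m (rcons h y) a *
  \sum_x wt m (rcons h x) s *
    ((q == cnt (rcons h x) :> nat)%:R * (y == ((q : nat) == 0%N))%:R)).
  by rewrite big_bool /=; ring.
under eq_bigr do rewrite e.
by rewrite big_bool; case: (y) => /=; ring.
Qed.

Lemma prelaw_ge0 s q u : 0 <= prelaw s q u.
Proof.
case: u => [[[m h] a]|] /=; last by rewrite !mulr_ge0 ?invr_ge0.
by rewrite !mulr_ge0 ?invr_ge0 ?mulr_ge0 ?wt_ge0 ?send_ge0.
Qed.

Lemma cycle_law_ge0 z : 0 <= cycle_law z.
Proof.
case: z => [[s u] q]; rewrite /cycle_law; do 3 apply: sumr_ge0 => ? _.
by rewrite !mulr_ge0 ?prelaw_ge0 ?PU_ge0.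
Qed.

Lemma cycle_policyP : policy cycle_policy.
Proof.
have [KN0 CN0] := KC_unit; split.
  move=> [[[m h] a]|] q [[[m' h'] a']|] //=.
    by rewrite !mulr_ge0 ?send_ge0.
  by rewrite !mulr_ge0 ?send_ge0 ?invr_ge0.
move=> [[[m h] a]|] q; rewrite big_state /=; last first.
  rewrite add0r (eq_bigr (fun=> K%:R^-1)).
    by rewrite sumr_const card_ord -[LHS]mulr_natl mulfV.
  move=> m _; rewrite (bigD1 [bseq]) //= [X in _ + X]big1 ?addr0; last first.
    move=> h hN; apply: big1 => b _.
    rewrite (_ : (h == [::] :> seq bool) = false).
      by rewrite mulr0 mul0r.
    by apply/negbTE; apply: contraNneq hN => e; apply/eqP/val_inj.
  by rewrite mulr1 -mulr_sumr send_sum mulr1.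
have [szh|szh] := eqVneq (size h) M.
  rewrite big1 ?addr0 // => m' _; apply: big1 => h' _; apply: big1 => b _.
  rewrite (_ : (h' == rcons h (q == ord0) :> seq bool) = false).
    by rewrite mulr0 mul0r.
  apply/negbTE; apply: contraTneq (size_bseq h') => ->.
  by rewrite size_rcons szh ltnn.
have szh' : (size (rcons h (q == ord0)) <= M)%N.
  by rewrite size_rcons ltn_neqAle szh size_bseq.
rewrite add0r (bigD1 m) //= [X in _ + X]big1 ?addr0; last first.
  move=> m' /negbTE mN; apply: big1 => h' _; apply: big1 => b _.
  by rewrite mN !mul0r.
rewrite (bigD1 (Bseq szh')) //= [X in _ + X]big1 ?addr0; last first.
  move=> h' hN; apply: big1 => b _.
  rewrite (_ : (h' == rcons h (q == ord0) :> seq bool) = false).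
    by rewrite mulr0 mul0r.
  by apply/negbTE; apply: contraNneq hN => e; apply/eqP/val_inj.
by rewrite !eqxx -mulr_sumr send_sum !mulr1.
Qed.

Let kern := kernelT eta shannon cycle_policy.

(** The reset and each of the [M.+1] history lengths carry mass 1 / [C]. *)
Lemma cycle_law_sum : \sum_z cycle_law z = 1.
Proof.
have [KN0 CN0] := KC_unit.
rewrite sum_state.
transitivity (\sum_(s : bool) \sum_(q < N.+1) \sum_(u : U) cycle_law (s, u, q)).
  by apply: eq_bigr => s _; rewrite exchange_big.
transitivity (\sum_(s : bool) \sum_(q < N.+1)
  (C%:R^-1 * s%:R * (q == ord_max)%:R +
  (K%:R * C%:R)^-1 * \sum_m \sum_(h : M.-bseq bool) \sum_x
    wt m (rcons h x) s * (q == cnt (rcons h x) :> nat)%:R)).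
  apply: eq_bigr => s _; apply: eq_bigr => q _.
  rewrite big_state cycle_law_none; congr (_ + _); rewrite mulr_sumr.
  apply: eq_bigr => m _; rewrite mulr_sumr; apply: eq_bigr => h _.
  by rewrite cycle_law_some.
have q1 k : (k <= N)%N -> \sum_(q < N.+1) (q == k :> nat)%:R = 1 :> R.
  rewrite -ltnS => kN.
  rewrite (eq_bigr (fun q : 'I_N.+1 => 1 * (q == Ordinal kN)%:R)) ?sum_mul_eq //.
  by move=> q _; rewrite mul1r.
under eq_bigr => s _.
  rewrite big_split /= -mulr_sumr (q1 N) // mulr1 -mulr_sumr exchange_big /=.
  under eq_bigr => m _.
    rewrite exchange_big /=.
    under eq_bigr => h _.
      rewrite exchange_big /=.
      under eq_bigr do rewrite -mulr_sumr q1 ?cnt_le // mulr1.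
      over.
    over.
  over.
rewrite big_split /= big_bool /= mulr0 addr0 mulr1 -mulr_sumr exchange_big /=.
rewrite (eq_bigr (fun=> M.+1%:R)).
  rewrite sumr_const card_ord -[_ *+ K]mulr_natl.
  have CE : C%:R = 1 + M.+1%:R :> R by rewrite /C [LHS]mulrS.
  by move: CN0; rewrite CE => CN0; field; apply/andP.
move=> m _; rewrite exchange_big /=.
rewrite (eq_bigr (fun h : M.-bseq bool => p m h)).
  rewrite big_bseq (eq_bigr (fun=> 1)) ?sumr_const ?card_ord // => k _.
  exact: sum_law (p_feasible m).
move=> h _; rewrite exchange_big /=.
rewrite (eq_bigr (fun x => p m (rcons h x))) => [|x _]; last exact: sum_wt.
by rewrite big_bool /= pD.
Qed.

(** A transition is a policy draw, which leads to [prelaw] by [cycle_step], followed by a channel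
    use, which leads back to [cycle_law] by definition. *)
Lemma cycle_law_stationary : stationary kern cycle_law.
Proof.
split; [exact: cycle_law_ge0|exact: cycle_law_sum|].
move=> [[sp up] qp]; rewrite sum_state /kern /kernelT /=.
rewrite {1}/cycle_law; apply: eq_bigr => s _.
rewrite [RHS]exchange_big /=; apply: eq_bigr => q _.
under [RHS]eq_bigr do rewrite mulr_sumr.
rewrite [RHS]exchange_big /=; apply: eq_bigr => x _.
rewrite -cycle_step !mulr_suml; apply: eq_bigr => u _; ring.
Qed.

(** * Certain return to the reset and uniqueness of the stationary law *)

Let z0 : bool * U * 'I_N.+1 := (true, None, ord_max).

Lemma policy_some m h b q u' : cycle_policy (Some (m, h, b)) q u' != 0 ->
  if u' is Some (_, h', a') then
    (size h' = (size h).+1) /\ (a' -> (size h' < n)%N)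
  else size h = M.
Proof.
case: u' => [[[m' h'] a']|] /=; last first.
  by rewrite pnatr_eq0 eqb0 negbK => /eqP.
rewrite !mulf_eq0 !negb_or => /andP[/andP[_ e] sN]; split.
  by move: e; rewrite pnatr_eq0 eqb0 negbK => /eqP ->; rewrite size_rcons.
by move=> a1; rewrite ltnNge; apply: contra sN => nh; rewrite a1 send_stop.
Qed.

Lemma policy_none q u' : cycle_policy None q u' != 0 ->
  if u' is Some (_, h', a') then
    (size h' = 0%N) /\ (a' -> (size h' < n)%N)
  else False.
Proof.
case: u' => [[[m' h'] a']|] /=; last by rewrite eqxx.
rewrite !mulf_eq0 !negb_or => /andP[/andP[_ e] sN]; split.
  by move: e; rewrite pnatr_eq0 eqb0 negbK => /eqP ->.
by move=> a1; rewrite ltnNge; apply: contra sN => nh; rewrite a1 send_stop.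
Qed.

(** A counter that keeps pace with the silent tail is full at the reset, whose 0 then charges
    surely. The successor in the bound on [q] is there because [q] already includes the output of
    the step made with history [h]. *)
Lemma reach_some j m (h : M.-bseq bool) (a s : bool) (q : 'I_N.+1) :
  (size h + j = M)%N ->
  ((n <= size h)%N -> (minn (size h - n).+1 N <= q)%N) ->
  reach kern z0 j.+1 (s, Some (m, h, a), q).
Proof.
elim: j m h a s q => [|j IH] m h a s q szh qle [[s' u'] q'] /kernelT_neq0[];
  move=> /policy_some; case: u' => [[[m' h'] a']|] /=.
- by move=> [e _]; have := size_bseq h'; rewrite e; lia.
- move=> _ -> PUN; have qN : q = ord_max.
    apply: val_inj; rewrite /=; have := ltn_ord q; have := qle.
    by rewrite addn0 in szh; rewrite szh /M; lia.
  move: PUN; rewrite qN gUo_max /PU eqxx orbT /=.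
  by case: s' => //; rewrite eqxx.
- move=> [e aP] -> _; apply: (IH m' h' a' s'); first by rewrite e; lia.
  move=> nh'; have af : a' = false.
    by apply/negP => /aP; rewrite ltnNge nh'.
  by rewrite af gUo_val gUF; move: nh' qle; rewrite e; lia.
by move=> e; lia.
Qed.

(** The cycle that follows contains the whole silent tail, so the initial [s] and [q] are
    forgotten. *)
Lemma reach_none s q : reach kern z0 C (s, None, q).
Proof.
move=> [[s' u'] q'] /kernelT_neq0[] /policy_none.
case: u' => [[[m' h'] a']|] //= [e aP] -> _.
apply: (@reach_some M m' h' a' s'); first by rewrite e.
move=> nh'; have af : a' = false.
  by apply/negP => /aP; rewrite ltnNge nh'.
by rewrite af gUo_val gUF e; lia.
Qed.

(** An arbitrary state may have too small a counter inside the tail, so the current cycle is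
    finished and one full cycle is added. *)
Lemma reach_all j m (h : M.-bseq bool) (a s : bool) (q : 'I_N.+1) :
  (size h + j = M)%N ->
  reach kern z0 (j.+1 + C) (s, Some (m, h, a), q).
Proof.
elim: j m h a s q => [|j IH] m h a s q szh [[s' u'] q'] /kernelT_neq0[];
  move=> /policy_some; case: u' => [[[m' h'] a']|] /=.
- by move=> [e _]; have := size_bseq h'; rewrite e; lia.
- by move=> _ _ _; exact: reach_none.
- by move=> [e _] _ _; apply: (IH m' h' a' s'); rewrite e; lia.
by move=> e; lia.
Qed.

Lemma cycle_law_unique : unique_stationary kern cycle_law.
Proof.
split=> [|pi' st']; first exact: cycle_law_stationary.
pose t (z : bool * U * 'I_N.+1) : nat :=
  if z.1.2 is Some (_, h, _) then ((M - size h).+1 + C)%N else C.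
apply: (@stationary_unique _ _ kern _ z0 C t) => //.
- by move=> z; apply: kernelT_sum; exact: cycle_policyP.
- exact: reach_none.
- move=> [[s [[[m h] a]|]] q]; last exact: reach_none.
  by apply: reach_all; rewrite subnKC // size_bseq.
- exact: cycle_law_stationary.
Qed.

(** * The mutual information of the cyclic policy *)

Let J (a : U * U) (x : bool) (q : 'I_N.+1) : R :=
  \sum_s \sum_sp \sum_qp
    joint eta shannon cycle_policy cycle_law s a.2 q a.1 x sp qp.

Lemma joint_sum a x q : J a x q =
  \sum_s cycle_law (s, a.2, q) * cycle_policy a.2 q a.1 * (x == shannon a.1 s)%:R.
Proof.
apply: eq_bigr => s _; rewrite /joint.
transitivity (\sum_sp cycle_law (s, a.2, q) * cycle_policy a.2 q a.1
    * (x == shannon a.1 s)%:R * PU N eta sp x s q).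
  apply: eq_bigr => sp _; rewrite -mulr_sumr.
  rewrite (eq_bigr (fun qp => 1 * (qp == gUo q x)%:R)).
    by rewrite sum_mul_eq mulr1.
  by move=> qp _; rewrite mul1r.
by rewrite -mulr_sumr PU_sum mulr1.
Qed.

Lemma joint_ge0 a x q : 0 <= J a x q.
Proof.
have [P0 _] := cycle_policyP.
rewrite joint_sum; apply: sumr_ge0 => s _.
by rewrite !mulr_ge0 ?cycle_law_ge0 // P0.
Qed.

Let V (u : U) (x : bool) (q : 'I_N.+1) : R :=
  \sum_s prelaw s q u * (x == shannon u s)%:R.

Lemma V_ge0 u x q : 0 <= V u x q.
Proof. by apply: sumr_ge0 => s _; rewrite mulr_ge0 ?prelaw_ge0. Qed.

Lemma joint_V up x q : \sum_u J (up, u) x q = V up x q.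
Proof.
under eq_bigr do rewrite joint_sum.
rewrite exchange_big /=; apply: eq_bigr => s _.
by rewrite -mulr_suml cycle_step.
Qed.

Lemma sum_V m (h : M.-bseq bool) x q : \sum_a V (Some (m, h, a)) x q =
  (K%:R * C%:R)^-1 * p m (rcons h x) * (q == cnt h :> nat)%:R.
Proof.
rewrite -(wt_out m h x) mulr_sumr mulr_suml; apply: eq_bigr => a _.
by rewrite mulr_sumr mulr_suml; apply: eq_bigr => s _ /=; ring.
Qed.

Let pX (x : bool) (q : 'I_N.+1) : R := \sum_a J a x q.
Let pQ (q : 'I_N.+1) : R := \sum_a \sum_x J a x q.
(** The stationary law of X given Q; it is 0 where [pQ q] vanishes, hence only sub-stochastic. *)
Let rX (x : bool) (q : 'I_N.+1) : R := pX x q / pQ q.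

Lemma pX_ge0 x q : 0 <= pX x q.
Proof. by apply: sumr_ge0 => a _; exact: joint_ge0. Qed.

Lemma pQE q : pQ q = pX true q + pX false q.
Proof. by rewrite /pQ exchange_big big_bool. Qed.

Lemma pXE x q : pX x q = \sum_u V u x q.
Proof.
rewrite /pX sum_pair; apply: eq_bigr => u _; exact: joint_V.
Qed.

Lemma rX_ge0 x q : 0 <= rX x q.
Proof. by rewrite divr_ge0 ?pQE ?addr_ge0 ?pX_ge0. Qed.

Lemma rX_sum q : rX true q + rX false q <= 1.
Proof.
rewrite /rX -mulrDl -pQE; have [->|pN0] := eqVneq (pQ q) 0.
  by rewrite mul0r ler01.
by rewrite mulfV.
Qed.

Lemma rX_le1 x q : rX x q <= 1.
Proof.
apply: le_trans (rX_sum q).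
by case: x; rewrite ?lerDl ?lerDr rX_ge0.
Qed.

Lemma rX_gt0 u x q : V u x q != 0 -> 0 < rX x q.
Proof.
move=> VN0.
have X0 : 0 < pX x q.
  rewrite pXE (bigD1 u) //= ltr_wpDr ?lt0r ?VN0 ?V_ge0 //.
  by apply: sumr_ge0 => u' _; exact: V_ge0.
rewrite divr_gt0 // pQE.
have := pX_ge0 true q; have := pX_ge0 false q.
by case: x {VN0} X0 => X0; lra.
Qed.

Let cnto (h : seq bool) : 'I_N.+1 := inord (cnt h).

Lemma cntoE h : cnto h = cnt h :> nat.
Proof. by rewrite inordK // ltnS cnt_le. Qed.

Lemma rX_hist m h x : (size h <= M)%N -> p m (rcons h x) != 0 ->
  0 < rX x (cnto h).
Proof.
have [KN0 CN0] := KC_unit.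
move=> szh pN0; have := sum_V m (Bseq szh) x (cnto h).
rewrite cntoE eqxx mulr1 big_bool /=.
have [V1|V1 _] := eqVneq (V (Some (m, Bseq szh, true)) x (cnto h)) 0.
  have [V2|V2 _] := eqVneq (V (Some (m, Bseq szh, false)) x (cnto h)) 0.
    rewrite V1 V2 addr0 => /esym/eqP.
    by rewrite !mulf_eq0 invr_eq0 mulf_eq0 (negbTE KN0) (negbTE CN0) (negbTE pN0).
  exact: rX_gt0 V2.
exact: rX_gt0 V1.
Qed.

(** Test channel for [cond_MI_ge]: it ignores the strategy bit, so that the law of the code itself
    appears in the logarithms. *)
Definition output_kernel (u : U) (x : bool) : R :=
  match u with
  | None => (x == false)%:R
  | Some (m, h, _) => p m (rcons h x) / p m h
  end.

(** The term of history [h] in the chain rule for the divergence of [p m] from [output_measure]. *)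
Let gain m (h : seq bool) : R := \sum_x p m (rcons h x) *
   ln (p m (rcons h x) / p m h / rX x (cnto h)).

Lemma MI_gain :
  (K%:R * C%:R)^-1 * (\sum_m \sum_(h : M.-bseq bool) gain m h) / ln 2
    <= MI_bound eta shannon cycle_policy cycle_law.
Proof.
have l2 : 0 < ln 2 :> R by rewrite ln_gt0 ?ltr1n.
pose w (a : U * U) x := output_kernel a.1 x.
have w0 a x : 0 <= w a x.
  case: a => [[[[m h] b]|] u'] //=.
  by rewrite divr_ge0 ?p_ge0.
have w1 a : \sum_x w a x <= 1.
  rewrite big_bool; case: a => [[[[m h] b]|] u'] /=; last by rewrite add0r.
  rewrite /w /= -mulrDl pD; have [->|pN0] := eqVneq (p m h) 0.
    by rewrite mul0r ler01.
  by rewrite mulfV.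
have Jw a x q : J a x q != 0 -> w a x != 0.
  case: a => [u u'] JN0.
  have VN0 : V u x q != 0.
    rewrite -joint_V gt_eqF // (bigD1 u') //= ltr_wpDr ?lt0r ?JN0 ?joint_ge0 //.
    by apply: sumr_ge0 => v _; exact: joint_ge0.
  case: u VN0 {JN0} => [[[m h] a]|] VN0; rewrite /w /=; last first.
    apply: contra VN0 => /eqP e; rewrite /V big1 // => s _ /=.
    by rewrite e mulr0.
  have pN0 : p m (rcons h x) != 0.
    apply: contra VN0 => /eqP p0.
    have := sum_V m h x q; rewrite p0 mulr0 mul0r => /eqP.
    rewrite psumr_eq0 => [/allP /(_ a)|a' _]; last exact: V_ge0.
    by rewrite mem_index_enum => /(_ isT).
  rewrite mulf_neq0 // invr_eq0 -(pD m h) paddr_eq0 ?p_ge0 // negb_and.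
  by case: (x) pN0 => ->; rewrite ?orbT.
apply: le_trans (cond_MI_ge joint_ge0 w0 w1 Jw).
rewrite sum_pair /=.
rewrite [leRHS](eq_bigr (fun u => \sum_x \sum_q V u x q *
    (ln (output_kernel u x / rX x q) / ln 2))); last first.
  move=> u _; rewrite exchange_big /=; apply: eq_bigr => x _.
  rewrite exchange_big /=; apply: eq_bigr => q _.
  by rewrite -joint_V [RHS]mulr_suml.
rewrite big_state; set A := (X in _ <= X + _).
have A0 : 0 <= A.
  apply: sumr_ge0 => -[] _; apply: sumr_ge0 => q _.
    by rewrite /V big1 ?mul0r // => s _; rewrite mulr0n mulr0.
  have [->|VN0] := eqVneq (V None false q) 0; first by rewrite mul0r.
  rewrite mulr_ge0 ?V_ge0 // divr_ge0 ?(ltW l2) //= ln_ge0 //.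
  by rewrite mul1r invf_ge1 ?(rX_gt0 VN0) ?rX_le1.
rewrite -[leLHS]add0r lerD // le_eqVlt; apply/orP; left; apply/eqP.
rewrite mulr_sumr mulr_suml; apply: eq_bigr => m _.
rewrite mulr_sumr mulr_suml; apply: eq_bigr => h _.
rewrite exchange_big /= /gain mulr_sumr mulr_suml; apply: eq_bigr => x _.
(* A history fixes Q, so only one value of q contributes. *)
rewrite exchange_big /= (bigD1 (cnto h)) //= [X in _ + X]big1 ?addr0.
  rewrite -mulr_suml sum_V cntoE eqxx mulr1; ring.
move=> q qN; rewrite -mulr_suml sum_V -cntoE (_ : (q == _ :> nat) = false).
  by rewrite mulr0 mul0r.
by apply/negbTE.
Qed.

(** Predicts each output from the counter alone, and so is the same for all messages, as [fano]
    requires. *)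
Definition output_measure (y : seq bool) : R :=
  \prod_(i < size y) rX (nth false y i) (cnto (take i y)).

Lemma output_measure_rcons h x :
  output_measure (rcons h x) = output_measure h * rX x (cnto h).
Proof.
rewrite /output_measure size_rcons big_ord_recr /= nth_rcons ltnn eqxx.
rewrite take_rcons // take_size; congr (_ * _); apply: eq_bigr => i _.
by rewrite nth_rcons ltn_ord take_rcons // ltnW.
Qed.

Lemma output_measure_ge0 y : 0 <= output_measure y.
Proof. by apply: prodr_ge0 => i _; exact: rX_ge0. Qed.

Lemma output_measure_sum k : \sum_(y : k.-tuple bool) output_measure y <= 1.
Proof.
elim: k => [|k IH].
  rewrite (big_pred1 [tuple]) /=; first by rewrite /output_measure big_ord0.
  by move=> t; apply/esym/eqP; rewrite (tuple0 t).
rewrite big_tuple_rcons; apply: le_trans IH; apply: ler_sum => h _.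
rewrite big_bool /= !output_measure_rcons -mulrDr ler_piMr ?rX_sum //.
exact: output_measure_ge0.
Qed.

(** In the silent tail the next output is 0 surely, so the logarithm is -ln [rX]. *)
Lemma gain_ge0 m h : (n <= size h <= M)%N -> 0 <= gain m h.
Proof.
move=> /andP[nh hM]; rewrite /gain big_bool /= p_stop // mul0r add0r.
have pE : p m (rcons h false) = p m h by rewrite -(pD m h) p_stop // add0r.
have [->|pN0] := eqVneq (p m (rcons h false)) 0; first by rewrite mul0r.
rewrite mulr_ge0 ?p_ge0 // ln_ge0 // -pE mulfV // mul1r.
by rewrite invf_ge1 ?rX_le1 ?(rX_hist hM pN0).
Qed.

(** Fano against [output_measure] bounds a divergence from below; the chain rule turns it into the
    gains of the first [n] steps, and [MI_gain] compares these with a whole cycle. *)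
Lemma cycle_MI (d : seq bool -> 'I_K) :
  (1 - K%:R^-1 * \sum_m \sum_(y : n.-tuple bool) p m y * (d y != m)%:R)
    * log2 K%:R - 1
  <= (n + N).+2%:R * MI_bound eta shannon cycle_policy cycle_law.
Proof.
have [KN0 CN0] := KC_unit.
have l2 : 0 < ln 2 :> R by rewrite ln_gt0 ?ltr1n.
have l2N : ln 2 != 0 :> R by rewrite gt_eqF.
have chain m := @chain_rule R (p m) output_measure
  (fun h x => rX x (cnto h)) n.
have {}chain m : (forall h, (size h <= n)%N -> p m h != 0 -> 0 < output_measure h)
   /\ \sum_(y : n.-tuple bool) p m y * ln (p m y / output_measure y) =
     \sum_(k < n) \sum_(h : k.-tuple bool) gain m h.
  have [p1 p0 pD' _] := p_feasible m.
  apply: chain => //.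
  - by rewrite /output_measure big_ord0.
  - exact: output_measure_rcons.
  - by move=> h x hn; apply: rX_hist; rewrite (leq_trans (ltnW hn)) ?leq_addr.
have F := @fano R (n.-tuple bool) K (fun y => d y) (fun m y => p m y)
  (fun y => output_measure y) K0 (fun m y => p_ge0 m y)
  (fun m => sum_law n (p_feasible m)) (fun y => output_measure_ge0 y)
  (output_measure_sum n).
have {F} F := F (fun m y pN0 =>
  lt0r_neq0 ((chain m).1 _ (eq_leq (size_tuple y)) pN0)).
set E := (1 - _) in F *.
have le : K%:R^-1 * \sum_m \sum_(y : n.-tuple bool)
    p m y * ln (p m y / output_measure y)
   <= K%:R^-1 * \sum_m \sum_(h : M.-bseq bool) gain m h.
  rewrite ler_wpM2l ?invr_ge0 //; apply: ler_sum => m _.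
  rewrite (chain m).2 big_bseq.
  rewrite (big_ord_widen M.+1 (fun k => \sum_(h : k.-tuple bool) gain m h)).
    (* The histories of length [n] to [M] lie in the silent tail and only add nonnegative gains. *)
    rewrite [leRHS](bigID (fun k : 'I_M.+1 => (k < n)%N)) /= lerDl.
    apply: sumr_ge0 => k kn; apply: sumr_ge0 => h _; apply: gain_ge0.
    by rewrite size_tuple leqNgt kn -ltnS ltn_ord.
  by rewrite ltnW // ltnS leq_addr.
have G := MI_gain.
have C0 : 0 < C%:R :> R by rewrite ltr0n.
rewrite -(ler_pM2l C0) in G; apply: le_trans G.
rewrite (_ : C%:R * _ = K%:R^-1 * (\sum_m \sum_(h : M.-bseq bool) gain m h)
  / ln 2); last by field; apply/and3P.
rewrite ler_pdivlMr //.
rewrite /log2 mulrBl mul1r -mulrA (divfK l2N).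
exact: le_trans F le.
Qed.

End Policy.

(** * The case N = 0 and the conclusion *)

(* For N = 0 the state Q is constant, so that H(X | Q) ignores the past of X:
   alternating 0 and 1 deterministically already gives one bit per step. *)
Section NoBoostMemory.
Variables (R : realType) (eta : R).
Hypothesis etaP : 0 <= eta <= 1.

Let f (u s : bool) := u && s.
Let P (u : bool) (q : 'I_1) (u' : bool) : R := (u' == ~~ u)%:R.
Let kern := kernelT eta f P.

(** After a 0 the battery is surely charged; after the 1 that follows it is charged with probability
    [eta]. *)
Definition alternating_law (z : bool * bool * 'I_1) : R :=
  let: (s, u, q) := z in
  2^-1 * (if u then (if s then eta else 1 - eta) else s%:R).

Lemma alternating_policy : policy P.
Proof.
split=> [u q u'|u q]; first by [].
by rewrite big_bool /P; case: u; rewrite /= ?addr0 ?add0r.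
Qed.

Lemma PU0_false sp s (q : 'I_1) : PU 0 eta sp false s q = sp%:R.
Proof. by rewrite (ord1 q) /PU /=; case: sp. Qed.

Lemma PU0_true sp s (q : 'I_1) : PU 0 eta sp true s q =
  if s then (if sp then eta else 1 - eta) else sp%:R.
Proof.
rewrite /PU /behc andbF; case: s; case: sp => /=; lra.
Qed.

Lemma alternating_stationary : stationary kern alternating_law.
Proof.
split.
- move=> [[s u] q]; rewrite mulr_ge0 ?invr_ge0 //.
  by case/andP: etaP => e0 e1; case: u => //; case: s; rewrite ?subr_ge0.
- rewrite sum_state; under eq_bigr do under eq_bigr do rewrite big_ord1.
  by rewrite !big_bool /=; lra.
move=> [[sp up] qp]; rewrite sum_state /kern /kernelT /P /f.
under eq_bigr do under eq_bigr do
  rewrite big_ord1 big_bool PU0_false PU0_true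
    (ord1 (gUo _ true)) (ord1 (gUo _ false)).
rewrite !big_bool (ord1 qp) eqxx.
by case: up; case: sp => /=; lra.
Qed.

Lemma alternating_unique : unique_stationary kern alternating_law.
Proof.
split=> [|pi' st']; first exact: alternating_stationary.
pose z0 : bool * bool * 'I_1 := (true, false, ord0).
have r1 s q : reach kern z0 1 (s, true, q).
  move=> [[s' u'] q'] /kernelT_neq0[]; case: u' => /=; first by rewrite eqxx.
  move=> _ -> ; rewrite PU0_false (ord1 (gUo _ _)).
  by case: s' => //; rewrite eqxx.
have r2 s q : reach kern z0 2 (s, false, q).
  move=> [[s' u'] q'] /kernelT_neq0[]; case: u' => /=; last by rewrite eqxx.
  by move=> _ _ _; exact: r1.
apply: (@stationary_unique _ _ kern _ z0 2
  (fun z : bool * bool * 'I_1 => if z.1.2 then 1%N else 2%N)) => //.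
- by move=> z; apply: kernelT_sum; exact: alternating_policy.
- exact: r2.
- by move=> [[s []] q]; [exact: r1|exact: r2].
- exact: alternating_stationary.
Qed.

(** Under the stationary law both strategies are functions of X, which is uniform, and Q is
    constant. *)
Lemma alternating_MI : MI_bound eta f P alternating_law = 1.
Proof.
have JE : (fun (a : bool * bool) (x : bool) (q : 'I_1) =>
    \sum_s \sum_sp \sum_qp joint eta f P alternating_law s a.2 q a.1 x sp qp)
  = (fun a x q => if a == (x, ~~ x) then 2^-1 else 0).
  apply/funext => -[u' u]; apply/funext => x; apply/funext => q.
  rewrite (eq_bigr (fun s =>
    alternating_law (s, u, q) * P u q u' * (x == f u' s)%:R)).
    rewrite big_bool /= /P /f.
    by case: u; case: u'; case: x => /=; lra.
  move=> s _; rewrite /joint.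
  under eq_bigr do rewrite big_ord1 (ord1 (gUo _ _)) eqxx mulr1.
  by rewrite -mulr_sumr PU_sum mulr1.
rewrite /MI_bound JE /cond_MI !sum_pair !big_bool !big_ord1 !sum_pair.
rewrite !big_bool /=.
have h0 : (2^-1 == 0 :> R) = false by rewrite invr_eq0 pnatr_eq0.
rewrite eqxx h0 !(add0r, addr0).
have -> : 2^-1 * (2^-1 + 2^-1) / (2^-1 * 2^-1) = 2 :> R by field.
rewrite /log2 divff ?gt_eqF ?ln_gt0 ?ltr1n //; lra.
Qed.

End NoBoostMemory.

Lemma code_rate_le (R : realType) (eta : R) (N n K : nat) (c : Defs.code n K) :
  0 <= eta <= 1 -> (0 < K)%N ->
  exists (U : finType) (f : U -> bool -> bool)
     (P : U -> 'I_N.+1 -> U -> R) (pi : bool * U * 'I_N.+1 -> R),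
     [/\ forall up, f up false = false, policy P,
         unique_stationary (kernelT eta f P) pi &
         (1 - err_prob N eta c) * log2 K%:R - 1
           <= (n + N).+2%:R * MI_bound eta f P pi].
Proof.
move=> etaP K0; have [p [pf pstop ->]] := code_law N c etaP.
case: N p pf pstop => [|N] p pf pstop; last first.
  exists _, (@shannon N.+1 n K), (@cycle_policy R N.+1 eta n K p),
    (@cycle_law R N.+1 eta n K p); split.
  - by case=> [[[m h] a]|] //=; rewrite andbF.
  - exact: cycle_policyP.
  - exact: cycle_law_unique.
  - exact: cycle_MI.
exists bool, (fun u s => u && s), (fun u _ u' => (u' == ~~ u)%:R),
  (alternating_law eta); split.
- by move=> u; rewrite andbF.
- exact: alternating_policy.
- exact: alternating_unique.
rewrite alternating_MI mulr1 addn0.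
have l2 : 0 < ln 2 :> R by rewrite ln_gt0 ?ltr1n.
have l2N : ln 2 != 0 :> R by rewrite gt_eqF.
have r0 : 0 < (2 ^+ n)^-1 :> R by rewrite invr_gt0 exprn_gt0.
have p0 m h : 0 <= p m h by case: (pf m).
(* For N = 0 the reference measure is uniform on the outputs, from which any law has divergence at
   most [n] bits. *)
have F := @fano R (n.-tuple bool) K (fun y => dec c y) (fun m y => p m y)
  (fun=> (2 ^+ n)^-1) K0 (fun m y => p0 m y) (fun m => sum_law n (pf m))
  (fun=> ltW r0) _ (fun _ _ _ => lt0r_neq0 r0).
have {F} F := F _; move: F.
set E := (1 - _) => F.
rewrite -(ler_pM2r l2) /log2 mulrBl mul1r -mulrA (divfK l2N).
apply: le_trans (F _) _.
  by rewrite sumr_const card_tuple card_bool -[leLHS]mulr_natl natrX mulfV //.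
rewrite ler_pdivrMl ?ltr0n //.
apply: (@le_trans _ _ (\sum_(m < K) n%:R * ln 2)).
  apply: ler_sum => m _.
  rewrite -[leRHS]mul1r -[X in X * (_ * _)](sum_law n (pf m)) mulr_suml.
  apply: ler_sum => y _; have [->|pN0] := eqVneq (p m y) 0; first by rewrite !mul0r.
  have pp : 0 < p m y by rewrite lt0r pN0 p0.
  rewrite ler_pM2l // invrK mulr_natl -lnXn ?ltr0n //.
  rewrite ler_ln ?posrE ?mulr_gt0 ?exprn_gt0 //.
  by rewrite ler_piMl ?exprn_ge0 // (law_le1 _ (pf m)).
rewrite sumr_const card_ord -[leLHS]mulr_natl ler_wpM2l //
  ?ler_wpM2r ?ler_nat ?(ltW l2) //.
by rewrite ltnW // ltnW.
Qed.

(** * From finite blocklength to the capacity *)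

Lemma nmsg_ge (R : realType) (r : R) n :
  (0 < nmsg r n)%N /\ n%:R * r <= log2 (nmsg r n)%:R.
Proof.
have pos : 0 < 2 `^ (n%:R * r) :> R by rewrite powR_gt0.
have le : 2 `^ (n%:R * r) <= (nmsg r n)%:R.
  rewrite /nmsg natr_absz; apply: le_trans (ceil_ge _) _.
  by rewrite ler_int ler_norm.
have N0 : 0 < (nmsg r n)%:R :> R by exact: lt_le_trans pos le.
split; first by rewrite -(ltr0n R).
rewrite /log2 ler_pdivlMr ?ln_gt0 ?ltr1n // -ln_powR.
by rewrite ler_ln ?posrE.
Qed.

Local Open Scope classical_set_scope.

Lemma rate_limit (R : realType) (e L : nat -> R) (r B : R) (N : nat) :
  e @ \oo --> 0 -> (forall n, n%:R * r <= L n) ->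
  (forall n, (1 - e n) * L n - 1 <= (n + N).+2%:R * B) -> r <= B.
Proof.
move=> e0 Lr H; rewrite leNgt; apply/negP => Br.
(* The bound 1 keeps [1 - e n] nonnegative; the other makes the loss [e n * r] at most half of
   [r - B]. The other half, times n, must then exceed the constant [1 + N.+2%:R * B], whence the
   threshold for n. *)
pose d := Num.min 1 ((r - B) / (2 * (`|r| + 1))).
have r1 : 0 < `|r| + 1 by rewrite ltr_wpDl.
have d0 : 0 < d.
  by rewrite /d lt_min ltr01 divr_gt0 ?subr_gt0 ?mulr_gt0.
have [n [en nA]] : exists n,
    `|e n| < d /\ (1 + N.+2%:R * B) / ((r - B) / 2) < n%:R.
  near \oo => n; exists n; split.
    by near: n; exact: (cvgr0_norm_lt _ e0).
  by near: n; exact: nbhs_infty_gtr.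
move: en; rewrite /d lt_min => /andP[e1].
rewrite ltr_pdivlMr ?mulr_gt0 // => e2.
have e3 : 0 <= 1 - e n by have := ler_norm (e n); lra.
have e4 : e n * r <= (r - B) / 2.
  have : e n * r <= `|e n| * (`|r| + 1).
    apply: le_trans (ler_norm _) _; rewrite normrM ler_wpM2l //; lra.
  lra.
move: nA; rewrite ltr_pdivrMr ?divr_gt0 ?subr_gt0 // => nA.
have := H n; have := ler_wpM2l e3 (Lr n).
have -> : (n + N).+2%:R = n%:R + N.+2%:R :> R by rewrite -natrD !addnS.
have n0 : 0 <= n%:R :> R by [].
have := ler_wpM2l n0 e4; lra.
Unshelve. all: by end_near.
Qed.

Local Close Scope classical_set_scope.
Unset Implicit Arguments.

Theorem theorem4 (R : realType) (eta : R) (N : nat) :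
  0 <= eta <= 1 -> (capacity N eta <= sup_bound N eta)%E.
Proof.
move=> etaP; apply: ge_ereal_sup => _ [r [c cvg_err] <-].
have le_sup n : exists2 v : R, (v%:E <= sup_bound N eta)%E &
   (1 - err_prob N eta (c n)) * log2 (nmsg r n)%:R - 1 <= (n + N).+2%:R * v.
  have [U [f [P [pi [f0 Pp st le]]]]] :=
    code_rate_le N (c n) etaP (nmsg_ge r n).1.
  exists (MI_bound eta f P pi) => //.
  by apply: ereal_sup_ubound; exists U, f, P, pi.
(* The value -oo is excluded because already blocklength 0 yields an admissible policy. *)
case: (sup_bound N eta) le_sup => [B| |] le_sup; last first.
- by have [v] := le_sup 0%N; rewrite leeNy_eq.
- by rewrite leey.
rewrite lee_fin.
apply: (rate_limit (N := N) cvg_err (fun n => (nmsg_ge r n).2)) => n.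
have [v] := le_sup n; rewrite lee_fin => vB /le_trans; apply.
by rewrite ler_wpM2l.
Qed.
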